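(* Let $\mathfrak{a}$ be a saturated ideal of ${}^b\mathbb{C}[X]={}^b\mathbb{C}[X_1,\dots,X_n]$ and $A={}^b\mathbb{C}[X]/\mathfrak{a}$. Then for every $m\in\mathbb{N}$ the exact sequence of $A^{an}$-modules $0\to I_A/I_A^{m+1}\to D(A)/I_A^{m+1}\to A^{an}\to0$ splits by a natural section $s:A^{an}\to D(A)/I_A^{m+1}$, namely $s(f)=F \bmod I_A^{m+1}$ for any $F\in A$ with $\mathrm{st}(F)=f$.
   Context: ${}^*\mathbb{C}$ is an ultrapower of $\mathbb{C}$; ${}^b\mathbb{C}$, ${}^i\mathbb{C}$ are the bounded and infinitesimal elements. ${}^b\mathbb{C}[X]$ is the ring of internal polynomials $P$ (elements of the ultrapower of $\mathbb{C}[X_1,\dots,X_n]$) with $P({}^b\mathbb{C}^n)\subset{}^b\mathbb{C}$; $\mathrm{st}:{}^b\mathbb{C}[X]\to\mathcal{O}(\mathbb{C}^n)$, $\mathrm{st}(P)(x)=$ standard part of $P(x)$. $D_n$ is the ring of internal polynomials $P(X,dX)$ in $X_1,\dots,X_n,dX_1,\dots,dX_n$ with $P(x,\xi)\in{}^b\mathbb{C}$ for all $x\in{}^b\mathbb{C}^n,\xi\in{}^i\mathbb{C}^n$. With $\delta(f)=f(X+dX)-f(X)$, $D(A):=D_n/(\mathfrak{a}D_n+\delta(\mathfrak{a})D_n)$, which contains $A$. $A^{an}:=\mathcal{O}(\mathbb{C}^n)/\overline{\mathrm{st}(\mathfrak{a})}$ (closure for the compact-open topology); $\mathrm{st}:A\to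 A^{an}$ and $\mathrm{st}:D(A)\to A^{an}$ (the latter induced by $P\mapsto\mathrm{st}(P(X,0))$) are the standard part maps, and $I_A$ is the kernel of the latter. $\mathfrak{a}$ is saturated if $\mathrm{st}(\mathfrak{a})=\overline{\mathrm{st}(\mathfrak{a})}$. *)

(* Defs.v *)
From HB Require Import structures.
From mathcomp Require Import all_boot all_order all_algebra.
From mathcomp Require Import reals.
From mathcomp Require Import complex.
From mathcomp Require Import mpoly.

Set Implicit Arguments.
Unset Strict Implicit.
Unset Printing Implicit Defensive.

Import Order.TTheory GRing.Theory Num.Theory.
Local Open Scope ring_scope.

Definition is_free_ultrafilter (U : (nat -> Prop) -> Prop) : Prop :=
  [/\ U (fun _ => True) /\ ~ U (fun _ => False),
      (forall A B : nat -> Prop, U A -> (forall i, A i -> B i) -> U B),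
      (forall A B : nat -> Prop, U A -> U B -> U (fun i => A i /\ B i)),
      (forall A : nat -> Prop, U A \/ U (fun i => ~ A i)) &
      (forall k : nat, ~ U (fun i => i = k))].

Section NS.
Variables (R : realType) (U : (nat -> Prop) -> Prop).
Local Notation C := (R[i]).

(* Elements of *C are represented by sequences nat -> C (modulo U). *)
Definition aeq {T : Type} (u v : nat -> T) : Prop := U (fun i => u i = v i).

Definition bnd (u : nat -> C) : Prop :=
  exists r : C, U (fun i => `|u i| <= r).

Definition infinitesimal (u : nat -> C) : Prop :=
  forall eps : C, 0 < eps -> U (fun i => `|u i| < eps).

Definition stpart (u : nat -> C) (c : C) : Prop :=
  forall eps : C, 0 < eps -> U (fun i => `|u i - c| < eps).

Definition bnd_pt n (x : nat -> 'I_n -> C) : Prop := forall j, bnd (fun i => x i j).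
Definition inf_pt n (x : nat -> 'I_n -> C) : Prop :=
  forall j, infinitesimal (fun i => x i j).

(* internal polynomials: representatives nat -> {mpoly C[N]} *)
Definition intpoly N := nat -> {mpoly C[N]}.

Definition bCX n (P : intpoly n) : Prop :=
  forall x : nat -> 'I_n -> C, bnd_pt x -> bnd (fun i => (P i).@[x i]).

Definition is_st n (P : intpoly n) (f : ('I_n -> C) -> C) : Prop :=
  forall x : 'I_n -> C, stpart (fun i => (P i).@[x]) (f x).

(* Variables of D_n: X_1..X_n are 'X_(lshift n j), dX_1..dX_n are 'X_(rshift n j) *)
Definition joinv n (x xi : 'I_n -> C) (j : 'I_(n + n)) : C :=
  match split j with inl a => x a | inr b => xi b end.

Definition Dn n (P : intpoly (n + n)) : Prop :=
  forall x xi : nat -> 'I_n -> C, bnd_pt x -> inf_pt xi ->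
    bnd (fun i => (P i).@[joinv (x i) (xi i)]).

Definition iotaX n (p : {mpoly C[n]}) : {mpoly C[n + n]} :=
  p \mPo [tuple 'X_(lshift n j) | j < n].
Definition deltaX n (p : {mpoly C[n]}) : {mpoly C[n + n]} :=
  p \mPo [tuple 'X_(lshift n j) + 'X_(rshift n j) | j < n] - iotaX p.

Definition gen_ideal n (G : intpoly (n + n) -> Prop) (Z : intpoly (n + n)) : Prop :=
  exists (k : nat) (P Q : 'I_k -> intpoly (n + n)),
    [/\ forall j, G (P j), forall j, Dn (Q j) &
        aeq Z (fun i => \sum_(j < k) P j i * Q j i)].

(* a is an ideal of ^bC[X] (a set of representatives closed under U-a.e.
   equality, i.e. a subset of the ultrapower ring) *)
Definition is_ideal n (a : intpoly n -> Prop) : Prop :=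
  [/\ forall P, a P -> bCX P,
      a (fun _ => 0),
      forall P Q, a P -> a Q -> a (fun i => P i + Q i),
      forall P Q, a P -> bCX Q -> a (fun i => Q i * P i) &
      forall P Q, a P -> aeq P Q -> a Q].

Definition st_ideal n (a : intpoly n -> Prop) (f : ('I_n -> C) -> C) : Prop :=
  exists P, a P /\ is_st P f.

(* closure for the compact-open topology (= uniform convergence on bounded
   subsets of C^n) *)
Definition in_closure n (S : (('I_n -> C) -> C) -> Prop)
  (f : ('I_n -> C) -> C) : Prop :=
  forall (r eps : C), 0 < eps -> exists g, S g /\
    forall x : 'I_n -> C, (forall j, `|x j| <= r) -> `|f x - g x| < eps.

Definition saturated n (a : intpoly n -> Prop) : Prop :=
  forall f, in_closure (st_ideal a) f -> st_ideal a f.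

Definition holomorphic n (f : ('I_n -> C) -> C) : Prop :=
  forall x : 'I_n -> C,
    (forall eps : C, 0 < eps -> exists2 d : C, 0 < d &
       forall y, (forall j, `|y j - x j| < d) -> `|f y - f x| < eps) /\
    (forall j : 'I_n, exists L : C, forall eps : C, 0 < eps ->
       exists2 d : C, 0 < d & forall h : C, `|h| < d ->
         `|f (fun k => if k == j then x k + h else x k) - f x - L * h|
            <= eps * `|h|).

Definition Jgen n (a : intpoly n -> Prop) (Z : intpoly (n + n)) : Prop :=
  exists P, a P /\ (Z = (fun i => iotaX (P i)) \/ Z = (fun i => deltaX (P i))).

(* preimage in D_n of I_A = ker (st : D(A) -> A^an) *)
Definition IApre n (a : intpoly n -> Prop) (P : intpoly (n + n)) : Prop :=
  Dn P /\ exists f, (forall x : 'I_n -> C,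
                       stpart (fun i => (P i).@[joinv x (fun _ => 0)]) (f x))
                    /\ in_closure (st_ideal a) f.

Definition IApow n (a : intpoly n -> Prop) (m : nat) (Z : intpoly (n + n)) : Prop :=
  exists Q : 'I_m -> intpoly (n + n),
    (forall j, IApre a (Q j)) /\ Z = (fun i => \prod_(j < m) Q j i).

(* preimage in D_n of I_A^m (an ideal of D(A) = D_n / J) *)
Definition IApow_ideal n (a : intpoly n -> Prop) (m : nat) : intpoly (n + n) -> Prop :=
  gen_ideal (fun Z => Jgen a Z \/ IApow a m Z).

End NS.

(* Main.v *)
Require Import Defs.
From mathcomp Require Import all_boot all_order all_algebra.
From mathcomp Require Import boolp reals complex mpoly.
From mathcomp Require Import ring lra.
Import Order.TTheory GRing.Theory Num.Theory.
Local Open Scope ring_scope.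

(* Surjectivity of st needs that an entire function f is a limit of
   polynomials, uniformly on polydisks.  This is obtained without integrals:
   trapezoidal sums over square boundaries are additive under subdivision, so
   Goursat's bisection gives a weak maximum principle
   |h(w)| <= 18 max |h| for h holomorphic off finitely many points near which
   it is bounded.  Since difference quotients of h stay in this class, the
   remainder of Newton interpolation is controlled, one variable at a time; the
   Newton coefficients are finite combinations of slices of f, hence entire in
   the remaining variables.
   For independence of F: by saturation F - F' agrees, modulo an element of the
   ideal, with some G whose standard part is 0.  The same maximum principle
   makes G Lipschitz on polydisks, so G is infinitesimal at all bounded points;
   by overspill G = (eta^-m G) eta^m with eta infinitesimal, a product of m + 1
   elements of I_A. *)

Set Implicit Arguments.
Unset Strict Implicit.
Unset Printing Implicit Defensive.

(** * The real-valued modulus of a complex number *)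

Section ComplexNorm.
Variable R : rcfType.
Implicit Types x y z : R[i].
Local Notation normc := (@Normc.normc R).

Lemma normE z : `|z| = (normc z)%:C%C.
Proof. by []. Qed.

Lemma ncD x y : normc (x + y) <= normc x + normc y.
Proof. by have := ler_normD x y; rewrite !normE -rmorphD /= lecR. Qed.

Lemma ncN x : normc (- x) = normc x.
Proof. by apply: complexI; rewrite -!normE normrN. Qed.

Lemma ncB x y : normc (x - y) <= normc x + normc y.
Proof. by rewrite -(ncN y) ncD. Qed.

Lemma ncC x y : normc (x - y) = normc (y - x).
Proof. by rewrite -ncN opprB. Qed.

Lemma nc_ge0 x : 0 <= normc x.
Proof. by have := normr_ge0 x; rewrite normE ler0c. Qed.

Lemma ncM x y : normc (x * y) = normc x * normc y.
Proof. exact: Normc.normcM. Qed.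

Lemma ncV x : normc x^-1 = (normc x)^-1.
Proof. exact: Normc.normcV. Qed.

Lemma nc0 : normc 0 = 0.
Proof. exact: Normc.normc0. Qed.

Lemma nc1 : normc 1 = 1.
Proof. exact: Normc.normc1. Qed.

Lemma nc_gt0 x : (0 < normc x) = (x != 0).
Proof. by rewrite -(normr_gt0 x) normE ltcE /= eqxx. Qed.

Lemma ncR (k : R) : normc k%:C%C = `|k|.
Proof. by rewrite /= expr0n addr0 sqrtr_sqr. Qed.

Lemma ncX x k : normc (x ^+ k) = normc x ^+ k.
Proof. by elim: k => [|k IH]; rewrite ?expr0 ?nc1 // !exprS ncM IH. Qed.

Lemma nc_prod (I : Type) (s : seq I) (F : I -> R[i]) :
  normc (\prod_(j <- s) F j) = \prod_(j <- s) normc (F j).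
Proof. by elim/big_rec2: _ => [|j x y _ <-]; rewrite ?nc1 ?ncM. Qed.

Lemma nc_sum (I : Type) (s : seq I) (F : I -> R[i]) :
  normc (\sum_(j <- s) F j) <= \sum_(j <- s) normc (F j).
Proof.
elim/big_rec2: _ => [|j x y _ h]; rewrite ?nc0 //.
by apply: le_trans (ncD _ _) _; rewrite lerD2l.
Qed.

Lemma nc_leD3 x y z : normc (x - z) <= normc (x - y) + normc (y - z).
Proof. by rewrite -[x - z](subrKA y) ncD. Qed.

Lemma nc_leB x y : normc x - normc y <= normc (x - y).
Proof. by rewrite lerBlDr -{1}[x](subrK y) ncD. Qed.

Lemma Im_le_nc x : complex.Im x <= normc x.
Proof.
case: x => a b /=; apply: le_trans (ler_norm _) _.
by rewrite -sqrtr_sqr ler_wsqrtr // lerDr sqr_ge0.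
Qed.

Lemma absRe_le_nc x : `|complex.Re x| <= normc x.
Proof. by case: x => a b /=; rewrite -sqrtr_sqr ler_wsqrtr // lerDl sqr_ge0. Qed.

Lemma absIm_le_nc x : `|complex.Im x| <= normc x.
Proof. by case: x => a b /=; rewrite -sqrtr_sqr ler_wsqrtr // lerDr sqr_ge0. Qed.

Lemma nci : normc 'i%C = 1.
Proof. by rewrite /= expr0n expr1n add0r sqrtr1. Qed.

Lemma nc_le_ReIm x : normc x <= `|complex.Re x| + `|complex.Im x|.
Proof.
rewrite {1}(complexE x); apply: le_trans (ncD _ _) _.
by rewrite ncM !ncR nci mul1r.
Qed.

Lemma posC_real (e : R[i]) : 0 < e -> exists2 d : R, 0 < d & e = d%:C%C.
Proof.
case: e => u v; rewrite ltcE /= => /andP[/eqP -> h].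
by exists u.
Qed.

Lemma nc_ltC z (e : R) : (`|z| < e%:C%C) = (normc z < e).
Proof. by rewrite normE ltcR. Qed.

Lemma nc_leC z (e : R) : (`|z| <= e%:C%C) = (normc z <= e).
Proof. by rewrite normE lecR. Qed.

Lemma nc_le_re z (r : R[i]) : `|z| <= r -> normc z <= complex.Re r.
Proof. by rewrite normE lecE /= => /andP[]. Qed.

End ComplexNorm.

(** * Goursat's lemma for trapezoidal sums *)

Section Edges.
Variable R : realType.
Local Notation C := R[i].
Local Notation normc := (@Normc.normc R).
Implicit Types (h g : C -> C) (z w d c : C).

(** Composite trapezoidal rule with [2 ^ k] equal pieces for the integral of [h] along the segment
    from [z] to [z + d]. Recursion by halving makes bisection of an edge hold by computation. *)
Fixpoint esum h (k : nat) z d : C :=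
  if k is k'.+1 then esum h k' z (d / 2) + esum h k' (z + d / 2) (d / 2)
  else (h z + h (z + d)) / 2 * d.

(** Discrete contour integral, counterclockwise, around the square with corner [c] and side [s]:
    bottom and right edges count positively, top and left ones negatively. *)
Definition qsum h k c (s : C) : C :=
  esum h k c s + esum h k (c + s) ('i%C * s)
  - esum h k (c + 'i%C * s) s - esum h k c ('i%C * s).

(** Every inner edge belongs to two quarter squares with opposite signs and cancels exactly; the
    outer edges are halved once, which uses up one level of [k]. *)
Lemma qsum_split h k c s :
  qsum h k.+1 c s = qsum h k c (s / 2) + qsum h k (c + s / 2) (s / 2)
    + qsum h k (c + 'i%C * (s / 2)) (s / 2)
    + qsum h k (c + s / 2 + 'i%C * (s / 2)) (s / 2).
Proof.
rewrite /qsum /= -!mulrA.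
have e1 : c + s / 2 + s / 2 = c + s by field.
have e2 : c + 'i%C * (s / 2) + 'i%C * (s / 2) = c + 'i%C * s by field.
have e3 : c + 'i%C * (s / 2) + s / 2 = c + s / 2 + 'i%C * (s / 2) by ring.
have e4 : c + s / 2 + 'i%C * (s / 2) + s / 2 = c + s + 'i%C * (s / 2) by field.
have e5 : c + s / 2 + 'i%C * (s / 2) + 'i%C * (s / 2)
   = c + 'i%C * s + s / 2 by field.
by rewrite e1 e2 e3 e4 e5; ring.
Qed.

Definition on_seg (P : C -> Prop) z d :=
  forall t : R, 0 <= t <= 1 -> P (z + t%:C%C * d).

Lemma on_seg_ends P z d : on_seg P z d -> P z /\ P (z + d).
Proof.
move=> H; have := H 0; have := H 1.
rewrite !lexx ler01 rmorph0 rmorph1 mul0r mul1r addr0 => /(_ isT) ? /(_ isT).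
by split.
Qed.

Lemma on_seg_halves P z d : on_seg P z d ->
  on_seg P z (d / 2) /\ on_seg P (z + d / 2) (d / 2).
Proof.
move=> H; split=> t /andP[t0 t1].
  have -> : z + t%:C%C * (d / 2) = z + (t / 2)%:C%C * d.
    by rewrite [(t / 2)%:C%C]rmorphM /= fmorphV rmorph_nat; ring.
  by apply: H; lra.
have -> : z + d / 2 + t%:C%C * (d / 2) = z + ((t + 1) / 2)%:C%C * d.
  rewrite [((t + 1) / 2)%:C%C]rmorphM /= fmorphV rmorphD rmorph1 rmorph_nat.
  by field.
by apply: H; lra.
Qed.

(** The trapezoidal rule is exact on affine functions; the subtracted term is their integral along
    the segment. *)
Lemma esum_affine h (a b : C) k z d :
  esum (fun u => h u - (a + b * u)) k z d
  = esum h k z d - (a * d + b * (z * d + d ^+ 2 / 2)).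
Proof. by elim: k z d => [|k IH] z d /=; rewrite ?IH; field. Qed.

Lemma qsum_affine h (a b : C) k c s :
  qsum (fun u => h u - (a + b * u)) k c s = qsum h k c s.
Proof. by rewrite /qsum !esum_affine; field. Qed.

Lemma esumB h g (a : C) k z d :
  esum (fun u => h u - a * g u) k z d = esum h k z d - a * esum g k z d.
Proof. by elim: k z d => [|k IH] z d /=; rewrite ?IH; field. Qed.

Lemma esum_bound h k (B : R) z d :
  on_seg (fun u => normc (h u) <= B) z d ->
  normc (esum h k z d) <= B * normc d.
Proof.
elim: k z d => [|k IH] z d.
  move=> H; have [h0 h1] := on_seg_ends H; rewrite /= ncM ler_wpM2r ?nc_ge0 // ncM ncV.
  have -> : normc 2 = 2 by rewrite -(rmorph_nat (real_complex R)) ncR ger0_norm.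
  by have := ncD (h z) (h (z + d)); lra.
move=> H; have [/IH h0 /IH h1] := on_seg_halves H; apply: le_trans (ncD _ _) _.
apply: le_trans (lerD h0 h1) _; rewrite ncM ncV.
have -> : normc 2 = 2 by rewrite -(rmorph_nat (real_complex R)) ncR ger0_norm.
by lra.
Qed.

(** The value on each half segment is a sum with integrand [h u * (d / 2)], so the bound [b] is
    shared equally between the halves. The factor [e] serves to choose a sign. *)
Lemma esum_Im_ge h k (e : C) (b : R) z d :
  on_seg (fun u => b <= complex.Im (e * (h u * d))) z d ->
  b <= complex.Im (e * esum h k z d).
Proof.
have half (x : C) : complex.Im (x / 2) = complex.Im x / 2.
  have -> : x / 2 = (2^-1)%:C%C * x by rewrite fmorphV rmorph_nat mulrC.
  by case: x => x1 x2 /=; rewrite mul0r addr0 mulrC.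
elim: k z d b => [|k IH] z d b.
  move=> H; have [] := on_seg_ends H.
  rewrite /=; set p := h z; set q := h _ => h0 h1.
  rewrite (_ : e * ((p + q) / 2 * d) = (e * (p * d) + e * (q * d)) / 2); last by field.
  by rewrite half raddfD /=; lra.
move=> H; have {}H : on_seg (fun u => b / 2 <= complex.Im (e * (h u * (d / 2)))) z d.
  by move=> t /H h0; rewrite !mulrA half -!mulrA; lra.
have [/IH h0 /IH h1] := on_seg_halves H.
by rewrite /= mulrDr raddfD /=; lra.
Qed.

Lemma nested_intervals (x y : nat -> R) :
  (forall k, x k <= y k) -> (forall k, x k <= x k.+1) ->
  (forall k, y k.+1 <= y k) -> exists t : R, forall k, x k <= t <= y k.
Proof.
move=> xy xS yS.
have xm i j : (i <= j)%N -> x i <= x j.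
  by move/subnK <-; elim: (j - i)%N => // m IH; exact: le_trans IH (xS _).
have ym i j : (i <= j)%N -> y j <= y i.
  by move/subnK <-; elim: (j - i)%N => // m IH; exact: le_trans (yS _) IH.
have lxy i j : x i <= y j.
  apply: le_trans (xm _ _ (leq_maxl i j)) _.
  exact: le_trans (xy _) (ym _ _ (leq_maxr i j)).
pose E : classical_sets.set R := fun t => exists k, t = x k.
have ubE j : classical_sets.ubound E (y j) by move=> _ [k ->].
have E0 : classical_sets.has_sup E by split; [exists (x 0%N), 0%N | exists (y 0%N); apply: ubE].
exists (sup E) => k; apply/andP; split.
  by apply: (sup_upper_bound E0); exists k.
by apply: ge_sup (ubE k); case: E0.
Qed.

(** If [P] failed on a square it would fail on one of its quarters, and so on; the nested closed
    squares shrink to a point, near which [P] holds by the local assumption. *)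
Lemma square_induction (P : R -> R -> R -> Prop) :
  (forall x y s, 0 < s -> P x y (s / 2) -> P (x + s / 2) y (s / 2) ->
     P x (y + s / 2) (s / 2) -> P (x + s / 2) (y + s / 2) (s / 2) -> P x y s) ->
  (forall x0 y0, exists2 d, 0 < d & forall x y s, 0 < s < d ->
     x <= x0 <= x + s -> y <= y0 <= y + s -> P x y s) ->
  forall x y s, 0 < s -> P x y s.
Proof.
move=> Psplit Ploc x y s s0; case: (pselect (P x y s)) => // nP; exfalso.
have /choice[F HF] : forall q : R * R * R, exists q' : R * R * R,
    let: (x, y, s) := q in let: (x', y', s') := q' in
    0 < s -> ~ P x y s -> [/\ ~ P x' y' s', s' = s / 2, x <= x' <= x + s / 2
       & y <= y' <= y + s / 2].
  move=> [[u v] t]; case: (pselect (0 < t)) => t0; last by exists (u, v, t).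
  have [p1|p1] := pselect (P u v (t / 2)); last first.
    by exists (u, v, t / 2); split=> //; lra.
  have [p2|p2] := pselect (P (u + t / 2) v (t / 2)); last first.
    by exists (u + t / 2, v, t / 2); split=> //; lra.
  have [p3|p3] := pselect (P u (v + t / 2) (t / 2)); last first.
    by exists (u, v + t / 2, t / 2); split=> //; lra.
  have [p4|p4] := pselect (P (u + t / 2) (v + t / 2) (t / 2)); last first.
    by exists (u + t / 2, v + t / 2, t / 2); split=> //; lra.
  by exists (u, v, t) => _ []; apply: Psplit.
pose q k := iter k F (x, y, s).
pose X k := (q k).1.1; pose Y k := (q k).1.2; pose S k := (q k).2.
have main k : ~ P (X k) (Y k) (S k) /\ S k = s / 2 ^+ k.
  elim: k => [|k [IH1 IH2]]; first by rewrite /S /= expr0 divr1.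
  have := HF (q k); rewrite /X /Y /S /q iterS -/(q k).
  move: IH1 IH2; rewrite /X /Y /S; case: (q k) => [[u v] t] /= n1 e1.
  case: (F _) => [[u' v'] t'] /=; case=> //.
    by rewrite e1 divr_gt0 // exprn_gt0.
  by move=> n2 e2 _ _; split; rewrite // e2; rewrite // e1 exprSr invfM mulrA.
have S0 k : 0 < S k by rewrite (main k).2 divr_gt0 // exprn_gt0.
have stp k : [/\ S k.+1 = S k / 2, X k <= X k.+1 <= X k + S k / 2
     & Y k <= Y k.+1 <= Y k + S k / 2].
  have := HF (q k); have := S0 k; have := (main k).1.
  rewrite /X /Y /S /q iterS -/(q k); case: (q k) => [[u v] t] /= n1 e1.
  by case: (F _) => [[u' v'] t'] /=; case.
have [|||x0 Hx] := @nested_intervals X (fun k => X k + S k).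
- by move=> k; have := S0 k; lra.
- by move=> k; have [_ /andP[]] := stp k.
- by move=> k; have [-> /andP[]] := stp k; have := S0 k; lra.
have [|||y0 Hy] := @nested_intervals Y (fun k => Y k + S k).
- by move=> k; have := S0 k; lra.
- by move=> k; have [_ _ /andP[]] := stp k.
- by move=> k; have [-> _ /andP[]] := stp k; have := S0 k; lra.
have [d d0 Pd] := Ploc x0 y0.
have [k hk] : exists k, S k < d.
  exists (Num.truncn (s / d)).+1; rewrite (main _).2 ltr_pdivrMr ?exprn_gt0 //.
  rewrite mulrC -ltr_pdivrMr //.
  apply: lt_le_trans (truncnS_gt _) _.
  by rewrite -natrX ler_nat ltnW // ltn_expl.
by apply: (main k).1; apply: Pd; rewrite ?S0.
Qed.

Definition diff_at h z := exists L : C, forall e : R, 0 < e ->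
  exists2 d : R, 0 < d & forall u, normc (u - z) < d ->
    normc (h u - h z - L * (u - z)) <= e * normc (u - z).

Definition bounded_near h z := exists B d : R, 0 < d /\
  forall u, normc (u - z) < d -> normc (h u) <= B.

Definition diff_off (E : seq C) h :=
  (forall z, z \notin E -> diff_at h z) /\ (forall z, bounded_near h z).

(* A point on an edge or a corner may lie in up to four closed squares of a
   subdivision; this sign count is additive under subdivision and is still at
   least 1 on every closed square that contains the point. *)
Definition point_mass (p : C) (x y s : R) : R :=
  (Num.sg (x + s - complex.Re p) - Num.sg (x - complex.Re p)) *
  (Num.sg (y + s - complex.Im p) - Num.sg (y - complex.Im p)).

Lemma point_mass_split p x y s : point_mass p x y s =
  point_mass p x y (s / 2) + point_mass p (x + s / 2) y (s / 2) +
  point_mass p x (y + s / 2) (s / 2) + point_mass p (x + s / 2) (y + s / 2) (s / 2).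
Proof.
rewrite /point_mass.
have -> : x + s / 2 + s / 2 = x + s by field.
have -> : y + s / 2 + s / 2 = y + s by field.
by ring.
Qed.

Lemma sg_step (a s : R) : 0 < s -> 0 <= Num.sg (a + s) - Num.sg a <= 2 /\
  (a <= 0 <= a + s -> 1 <= Num.sg (a + s) - Num.sg a).
Proof.
by move=> s0; case: (sgrP a); case: (sgrP (a + s)) => *; split; lra.
Qed.

Lemma point_mass_bound p x y s : 0 < s ->
  0 <= point_mass p x y s <= 4 /\
  (x <= complex.Re p <= x + s -> y <= complex.Im p <= y + s ->
   1 <= point_mass p x y s).
Proof.
move=> s0; rewrite /point_mass.
have -> : x + s - complex.Re p = x - complex.Re p + s by ring.
have -> : y + s - complex.Im p = y - complex.Im p + s by ring.
have [h1 h1'] := sg_step (x - complex.Re p) s0.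
have [h2 h2'] := sg_step (y - complex.Im p) s0.
split; first by nra.
move=> hx hy; have {}h1' := h1' ltac:(lra); have {}h2' := h2' ltac:(lra).
by nra.
Qed.

End Edges.

Section Goursat.
Variable R : realType.
Local Notation C := R[i].
Local Notation normc := (@Normc.normc R).
Implicit Types (h g : C -> C) (z w d c : C) (E : seq C).

Definition on_square_boundary (P : C -> Prop) (x y s : R) :=
  [/\ on_seg P (Complex x y) s%:C%C,
      on_seg P (Complex x y + s%:C%C) ('i%C * s%:C%C),
      on_seg P (Complex x y + 'i%C * s%:C%C) s%:C%C
    & on_seg P (Complex x y) ('i%C * s%:C%C)].

Lemma on_square_boundaryP (P : C -> Prop) (x y s : R) : 0 <= s ->
  (forall u v, x <= u <= x + s -> y <= v <= y + s ->
     [\/ u = x, u = x + s, v = y | v = y + s] -> P (Complex u v)) ->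
  on_square_boundary P x y s.
Proof.
move=> s0 H.
have K (t : R) : 0 <= t <= 1 -> 0 <= t * s <= s by move=> ?; nra.
split=> t /K ts.
- rewrite (_ : _ + _ = Complex (x + t * s) y); last by simpc.
  by apply: H; [lra|lra|apply: Or43].
- rewrite (_ : _ + _ = Complex (x + s) (y + t * s)); last by simpc.
  by apply: H; [lra|lra|apply: Or42].
- rewrite (_ : _ + _ = Complex (x + t * s) (y + s)); last by simpc.
  by apply: H; [lra|lra|apply: Or44].
- rewrite (_ : _ + _ = Complex x (y + t * s)); last by simpc.
  by apply: H; [lra|lra|apply: Or41].
Qed.

Lemma qsum_bound h k (x y s B : R) : 0 <= s ->
  on_square_boundary (fun u => normc (h u) <= B) x y s ->
  normc (qsum h k (Complex x y) s%:C%C) <= 4 * s * B.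
Proof.
move=> s0 [h1 h2 h3 h4]; rewrite /qsum.
have ns : normc s%:C%C = s by rewrite ncR ger0_norm.
have nis : normc ('i%C * s%:C%C) = s by rewrite ncM nci mul1r.
have := esum_bound k h1; have := esum_bound k h2.
have := esum_bound k h3; have := esum_bound k h4; rewrite ns nis.
set e4 := esum _ _ _ _; set e3 := esum _ _ _ _.
set e2 := esum _ _ _ _; set e1 := esum _ _ _ _ => b4 b3 b2 b1.
have := ncB (e1 + e2 - e3) e4; have := ncB (e1 + e2) e3; have := ncD e1 e2.
by lra.
Qed.

Lemma diff_at_bounded h z : diff_at h z -> bounded_near h z.
Proof.
case=> L /(_ 1 ltr01)[d d0 H].
exists (normc (h z) + (normc L + 1) * d), d; split=> // u ud.
have -> : h u = h z + L * (u - z) + (h u - h z - L * (u - z)) by ring.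
have := ncD (h z + L * (u - z)) (h u - h z - L * (u - z)).
have := ncD (h z) (L * (u - z)); rewrite ncM; have := H u ud.
have : normc L * normc (u - z) <= normc L * d.
  by rewrite ler_wpM2l ?nc_ge0 // ltW.
by move: ud; lra.
Qed.

(** Bisection reduces the estimate to small squares around one point, provided the right-hand side
    is additive under quartering. *)
Lemma diff_off_goursat E h (x y s eta : R) : 0 < s -> 0 < eta -> diff_off E h ->
  exists J, forall k, (J <= k)%N ->
    normc (qsum h k (Complex x y) s%:C%C) <= eta.
Proof.
move=> s0 eta0 [hd hb].
(* Both summands are additive. The area pays for squares around points of differentiability, the
   point masses for squares around points of [E]. *)
pose mu x y s : R := s ^+ 2 + \sum_(p <- E) point_mass p x y s.
have mu_ge x' y' s' : 0 < s' -> s' ^+ 2 <= mu x' y' s'.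
  move=> s'0; rewrite /mu lerDl; apply: sumr_ge0 => p _.
  by have [/andP[]] := point_mass_bound p x' y' s'0.
pose e := eta / (mu x y s + 1).
have mu0 : 0 <= mu x y s by apply: le_trans (mu_ge _ _ _ s0); rewrite sqr_ge0.
have e0 : 0 < e by rewrite divr_gt0 // ltr_wpDl.
pose P x y s := exists J, forall k, (J <= k)%N ->
  normc (qsum h k (Complex x y) s%:C%C) <= e * mu x y s.
suff [J HJ] : P x y s.
  exists J => k /HJ /le_trans; apply.
  by rewrite /e mulrAC ler_pdivrMr ?ltr_wpDl // ler_pM2l // lerDl.
apply: square_induction s0 => {mu0}.
- move=> a b t t0 [J1 H1] [J2 H2] [J3 H3] [J4 H4].
  (* The successor compensates for the level that [qsum_split] uses up. *)
  exists (maxn (maxn J1 J2) (maxn J3 J4)).+1 => -[//|k].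
  rewrite ltnS !geq_max => /andP[/andP[/H1 h1 /H2 h2] /andP[/H3 h3 /H4 h4]].
  rewrite qsum_split.
  have t2 : t%:C%C / 2 = (t / 2)%:C%C by rewrite rmorphM /= fmorphV rmorph_nat.
  rewrite t2.
  have -> : Complex a b + (t / 2)%:C%C = Complex (a + t / 2) b by simpc.
  have -> : Complex a b + 'i%C * (t / 2)%:C%C = Complex a (b + t / 2) by simpc.
  have -> : Complex (a + t / 2) b + 'i%C * (t / 2)%:C%C =
     Complex (a + t / 2) (b + t / 2) by simpc.
  have -> : mu a b t = mu a b (t / 2) + mu (a + t / 2) b (t / 2)
      + mu a (b + t / 2) (t / 2) + mu (a + t / 2) (b + t / 2) (t / 2).
    rewrite /mu (eq_bigr _ (fun p _ => point_mass_split p a b t)) !big_split /=.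
    by field.
  move: h1 h2 h3 h4; set q1 := qsum _ _ _ _; set q2 := qsum _ _ _ _.
  set q3 := qsum _ _ _ _; set q4 := qsum _ _ _ _.
  have := ncD (q1 + q2 + q3) q4; have := ncD (q1 + q2) q3; have := ncD q1 q2.
  by clearbody mu e; lra.
- move=> x0 y0; have [pE|pE] := boolP (Complex x0 y0 \in E).
    have [B [d [d0 HB]]] := hb (Complex x0 y0).
    have B0 : 0 <= B.
      by apply: le_trans (nc_ge0 _) (HB (Complex x0 y0) _); rewrite subrr nc0.
    have B1 : 0 < 4 * B + 1 by lra.
    (* The first bound keeps the square inside the disk where [h] is bounded by [B]; the second
       makes perimeter times [B] at most [e], while the mass of the point is at least 1. *)
    exists (Num.min (d / 2) (e / (4 * B + 1))); first by rewrite lt_min; apply/andP; split; apply: divr_gt0.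
    move=> a b t; rewrite lt_min => /and3P[t0 td te] ha hb'.
    exists 0%N => k _.
    apply: le_trans (_ : 4 * t * B <= _).
      apply: qsum_bound; first exact: ltW.
      apply: on_square_boundaryP; first exact: ltW.
      move=> u v hu hv _; apply: HB; apply: le_lt_trans (nc_le_ReIm _) _ => /=.
      have h1 : `|u - x0| <= t by rewrite ler_norml; lra.
      have h2 : `|v - y0| <= t by rewrite ler_norml; lra.
      by lra.
    apply: le_trans (_ : e * 1 <= _).
      by move: te; rewrite ltr_pdivlMr; lra.
    rewrite ler_pM2l //.
    have [_ /(_ ha hb') h1] := point_mass_bound (Complex x0 y0) a b t0.
    apply: le_trans h1 _; rewrite /mu (perm_big _ (perm_to_rem pE)) big_cons /=.
    have : 0 <= \sum_(p <- rem (Complex x0 y0) E) point_mass p a b t.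
      apply: sumr_ge0 => p _.
      by have [/andP[]] := point_mass_bound p a b t0.
    by have := sqr_ge0 t; lra.
- have [L HL] := hd _ pE.
  (* After subtraction of the affine part the integrand is at most [e / 8] times a distance of at
     most [2 * t]; the perimeter [4 * t] then gives exactly [e * t ^+ 2]. *)
  have [d d0 Hd] := HL (e / 8) ltac:(lra).
  exists (d / 2); first by lra.
  move=> a b t /andP[t0 td] ha hb'; exists 0%N => k _.
  set z := Complex x0 y0 in Hd.
  rewrite -(qsum_affine h (h z - L * z) L).
  apply: le_trans (_ : 4 * t * (e / 8 * (2 * t)) <= _).
    apply: qsum_bound; first exact: ltW.
    apply: on_square_boundaryP; first exact: ltW.
    move=> u v hu hv _.
    have huv : normc (Complex u v - z) <= 2 * t.
      apply: le_trans (nc_le_ReIm _) _ => /=.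
      have h1 : `|u - x0| <= t by rewrite ler_norml; lra.
      have h2 : `|v - y0| <= t by rewrite ler_norml; lra.
      by lra.
    rewrite (_ : _ - _ = h (Complex u v) - h z - L * (Complex u v - z)); last by ring.
    apply: le_trans (Hd _ _) _; first by lra.
    by rewrite ler_pM2l //; lra.
  rewrite (_ : 4 * t * _ = e * t ^+ 2); last by field.
  by rewrite ler_pM2l // mu_ge.
Qed.

(** * Difference quotients *)

Lemma diff_at_quot h (c w z : C) : z != w -> diff_at h z ->
  diff_at (fun u => (h u - c) / (u - w)) z.
Proof.
move=> zw [L HL].
have m0 : 0 < normc (z - w) by rewrite nc_gt0 subr_eq0.
have zw0 : z - w != 0 by rewrite subr_eq0.
set m := normc (z - w) in m0.
pose D := (h z - c) / (z - w); set K := normc (L - D).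
have K0 : 0 <= K by exact: nc_ge0.
(* The derivative given by the quotient rule, [D] being the value of the quotient at [z]. *)
exists ((L - D) / (z - w)) => e e0.
have [d d0 Hd] := HL (e * m / 4) ltac:(nra).
pose d2 := e * m ^+ 2 / (4 * (K + 1)).
have d20 : 0 < d2 by rewrite divr_gt0 ?mulr_gt0 ?exprn_gt0 //; lra.
(* Within [m / 2] of [z] the denominator stays above [m / 2]; [d2] controls the quadratic term of
   the remainder. *)
exists (Num.min (m / 2) (Num.min d d2)); first by rewrite !lt_min d0 d20; lra.
move=> u; rewrite !lt_min => /and3P[u1 u2 u3].
have um : m / 2 < normc (u - w).
  by have := nc_leD3 z u w; rewrite (ncC z u) -/m; lra.
have uw0 : u - w != 0 by rewrite -nc_gt0; lra.
set rho := h u - h z - L * (u - z).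
have -> : (h u - c) / (u - w) - (h z - c) / (z - w) - (L - D) / (z - w) * (u - z)
   = (rho - (L - D) * (u - z) ^+ 2 / (z - w)) / (u - w).
  by rewrite /rho /D; field; rewrite uw0.
rewrite ncM ncV ler_pdivrMr; last by lra.
apply: le_trans (_ : e * normc (u - z) * (m / 2) <= _); last first.
  by rewrite ler_wpM2l ?mulr_ge0 ?nc_ge0 // ltW.
apply: le_trans (ncB _ _) _.
rewrite (ncM _ (z - w)^-1) (ncM (L - D)) ncV ncX -/K -/m.
have h1 : normc rho <= e * m / 4 * normc (u - z) by exact: Hd.
have h2 : K * normc (u - z) ^+ 2 / m <= e * m / 4 * normc (u - z).
  rewrite ler_pdivrMr // expr2 mulrA mulrAC [X in _ <= X]mulrAC.
  rewrite ler_wpM2r ?nc_ge0 //.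
  have : normc (u - z) * (4 * (K + 1)) <= e * m ^+ 2.
    by rewrite -ler_pdivlMr ?ltW //; lra.
  by have := nc_ge0 (u - z); nra.
by lra.
Qed.

(** At [z = w] the value is 0, since division by zero gives 0. *)
Definition dq h w z : C := (h z - h w) / (z - w).

(** Away from [w] the quotient rule applies; near [w] differentiability of [h] bounds the quotient,
    so [w] merely joins the exceptional points. *)
Lemma diff_off_dq E h w : w \notin E -> diff_off E h -> diff_off (w :: E) (dq h w).
Proof.
move=> wE [hd hb]; split=> z.
  by rewrite inE negb_or => /andP[zw zE]; apply: diff_at_quot zw (hd _ zE).
have [->|zw] := eqVneq z w.
  have [L /(_ 1 ltr01)[d d0 Hd]] := hd _ wE.
  exists (normc L + 1), d; split=> // u ud.
  have [->|uw] := eqVneq u w.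
    by rewrite /dq !subrr mul0r nc0; have := nc_ge0 L; lra.
  rewrite /dq ncM ncV ler_pdivrMr ?nc_gt0 ?subr_eq0 //.
  rewrite -[h u - h w](subrK (L * (u - w))).
  by apply: le_trans (ncD _ _) _; rewrite ncM; have := Hd u ud; lra.
have [B [d [d0 HB]]] := hb z.
have m0 : 0 < normc (z - w) by rewrite nc_gt0 subr_eq0.
set m := normc (z - w) in m0.
exists ((B + normc (h w)) / (m / 2)), (Num.min d (m / 2)); split.
  by rewrite lt_min d0; lra.
move=> u; rewrite lt_min => /andP[/HB hu u2].
have um : m / 2 < normc (u - w).
  by have := nc_leD3 z u w; rewrite (ncC z u) -/m; lra.
rewrite /dq ncM ncV ler_pM ?nc_ge0 ?invr_ge0 ?nc_ge0 //.
  by apply: le_trans (ncB _ _) _; rewrite lerD2r.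
by rewrite lef_pV2 ?posrE ?ltW //; lra.
Qed.

(** * A maximum principle from the winding number of a square *)

Lemma ImN z : complex.Im (- z) = - complex.Im z.
Proof. by case: z. Qed.

Lemma ImD z w : complex.Im (z + w) = complex.Im z + complex.Im w.
Proof. by case: z; case: w. Qed.

Lemma Im_invM (p q s : R) :
  complex.Im ((Complex p q)^-1 * s%:C%C) = - q / (p ^+ 2 + q ^+ 2) * s.
Proof. by simpc => /=; ring. Qed.

Lemma Im_invMi (p q s : R) :
  complex.Im ((Complex p q)^-1 * ('i%C * s%:C%C)) = p / (p ^+ 2 + q ^+ 2) * s.
Proof. by simpc => /=; ring. Qed.

(** A crude substitute for the value [2 * pi * i] of the integral. The distance from [w] to the line
    carrying an edge lies between [T / 2] and [3 / 2 * T], so each of the four edges contributes at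
    least [2 / 9] to the imaginary part. *)
Lemma winding_lower_bound k w (T : R) : 0 < T -> normc w <= T / 2 ->
  8 / 9 <= normc (qsum (fun u => (u - w)^-1) k (Complex (- T) (- T)) (2 * T)%:C%C).
Proof.
case: w => a b T0 hw; apply: le_trans (Im_le_nc _); rewrite /qsum.
have ha := le_trans (absRe_le_nc _) hw; have hb := le_trans (absIm_le_nc _) hw.
move: ha hb; rewrite /= !ler_norml => ha hb.
(* The factor [- 1] on the top and left edges reflects their sign in [qsum]. *)
have [H1 H2 H3 H4] : [/\ 
   on_seg (fun u => 2 / 9 <= complex.Im (1 * ((u - Complex a b)^-1 * (2 * T)%:C%C)))
     (Complex (- T) (- T)) (2 * T)%:C%C,
   on_seg (fun u => 2 / 9 <= complex.Im (1 * ((u - Complex a b)^-1 * ('i%C * (2 * T)%:C%C))))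
     (Complex (- T) (- T) + (2 * T)%:C%C) ('i%C * (2 * T)%:C%C),
   on_seg (fun u => 2 / 9 <= complex.Im (- 1 * ((u - Complex a b)^-1 * (2 * T)%:C%C)))
     (Complex (- T) (- T) + 'i%C * (2 * T)%:C%C) (2 * T)%:C%C
 & on_seg (fun u => 2 / 9 <= complex.Im (- 1 * ((u - Complex a b)^-1 * ('i%C * (2 * T)%:C%C))))
     (Complex (- T) (- T)) ('i%C * (2 * T)%:C%C)].
  have key (p q : R) : T / 2 <= q <= 3 / 2 * T -> - (3 / 2 * T) <= p <= 3 / 2 * T ->
     2 / 9 <= q / (p ^+ 2 + q ^+ 2) * (2 * T).
    move=> hq hp; have n0 : 0 < p ^+ 2 + q ^+ 2 by nra.
    by rewrite mulrAC ler_pdivlMr //; nra.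
  split=> t ht; (have {}ht : 0 <= t * (2 * T) <= 2 * T by nra).
  - rewrite (_ : _ - _ = Complex (- T + t * (2 * T) - a) (- (T + b))); last first.
      by simpc; congr Complex; ring.
    by rewrite mul1r Im_invM opprK sqrrN; apply: key; lra.
  - rewrite (_ : _ - _ = Complex (T - a) (- T + t * (2 * T) - b)); last first.
      by simpc; congr Complex; ring.
    by rewrite mul1r Im_invMi [_ ^+ 2 + _]addrC; apply: key; lra.
  - rewrite (_ : _ - _ = Complex (- T + t * (2 * T) - a) (T - b)); last first.
      by simpc; congr Complex; ring.
    by rewrite mulN1r ImN Im_invM !mulNr opprK; apply: key; lra.
  - rewrite (_ : _ - _ = Complex (- (T + a)) (- T + t * (2 * T) - b)); last first.
      by simpc; congr Complex; ring.
    rewrite mulN1r ImN Im_invMi !mulNr opprK sqrrN [_ ^+ 2 + _]addrC.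
    by apply: key; lra.
have E1 := esum_Im_ge k H1; have E2 := esum_Im_ge k H2.
have E3 := esum_Im_ge k H3; have E4 := esum_Im_ge k H4.
rewrite !mul1r !mulN1r in E1 E2 E3 E4.
rewrite !(ImD, ImN) in E1 E2 E3 E4 *; lra.
Qed.

(** Cauchy's formula with error terms. By Goursat the sum for [dq h w] is negligible, so [h w] times
    the winding sum is close to the sum for [h u / (u - w)]. On the square of half-side [T], which
    lies in the annulus, the latter is at most [8 * T * (M / (T / 2)) = 16 * M]; dividing by [8 / 9]
    gives 18. *)
Lemma weak_maximum E h w (T M : R) : 0 < T -> normc w <= T / 2 -> w \notin E ->
  diff_off E h -> (forall u, T <= normc u <= 2 * T -> normc (h u) <= M) ->
  normc (h w) <= 18 * M.
Proof.
move=> T0 hw wE hE hM; apply/ler_addgt0Pr => e e0.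
have T20 : 0 < 2 * T by lra.
have e20 : 0 < e / 2 by lra.
have [J /(_ J (leqnn J)) HJ] := diff_off_goursat (- T) (- T) T20 e20 (diff_off_dq wE hE).
have W := winding_lower_bound J T0 hw.
move: HJ; have -> : qsum (dq h w) J (Complex (- T) (- T)) (2 * T)%:C%C =
  qsum (fun u => h u / (u - w)) J (Complex (- T) (- T)) (2 * T)%:C%C
  - h w * qsum (fun u => (u - w)^-1) J (Complex (- T) (- T)) (2 * T)%:C%C.
  have -> : dq h w = (fun u => h u / (u - w) - h w * (u - w)^-1).
    by apply: funext => u; rewrite /dq mulrBl.
  by rewrite /qsum !esumB; ring.
have : normc (qsum (fun u => h u / (u - w)) J (Complex (- T) (- T)) (2 * T)%:C%C)
   <= 4 * (2 * T) * (M / (T / 2)).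
  apply: qsum_bound; first exact: ltW.
  apply: on_square_boundaryP; first exact: ltW.
  move=> u v hu hv huv.
  have h1 : T <= normc (Complex u v).
    have := absRe_le_nc (Complex u v); have := absIm_le_nc (Complex u v).
    rewrite [complex.Re _]/= [complex.Im _]/=.
    have := ler_norm u; have := ler_norm (- u); rewrite normrN.
    have := ler_norm v; have := ler_norm (- v); rewrite normrN.
    by case: huv; lra.
  have h2 : normc (Complex u v) <= 2 * T.
    apply: le_trans (nc_le_ReIm _) _ => /=.
    have u1 : `|u| <= T by rewrite ler_norml; lra.
    have v1 : `|v| <= T by rewrite ler_norml; lra.
    by lra.
  rewrite ncM ncV ler_pM ?nc_ge0 ?invr_ge0 ?nc_ge0 //; first by apply: hM; rewrite h1.
  have h3 : T / 2 <= normc (Complex u v - w).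
    by have := nc_leB (Complex u v) w; lra.
  by rewrite lef_pV2 ?posrE //; lra.
have -> : 4 * (2 * T) * (M / (T / 2)) = 16 * M by field; lra.
set q1 := qsum _ _ _ _; set q2 := qsum _ _ _ _ in W *.
move=> b1 b2; have := nc_leB (h w * q2) q1; rewrite ncC ncM.
have := nc_ge0 (h w); nra.
Qed.

End Goursat.

(** * Newton interpolation of entire functions *)

Section Newton.
Variable R : realType.
Local Notation C := R[i].
Local Notation normc := (@Normc.normc R).
Implicit Types (h g : C -> C) (z w : C) (E : seq C).

(** Pairwise distinct interpolation nodes in the unit disk. *)
Definition node (k : nat) : C := (k.+1%:R)^-1.

Lemma node_inj : injective node.
Proof.
by move=> k l /invr_inj /eqP; rewrite eqr_nat => /eqP [].
Qed.

Lemma node_le1 k : normc (node k) <= 1.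
Proof.
rewrite ncV -(rmorph_nat (real_complex R)) ncR ger0_norm ?ler0n //.
by rewrite invf_le1 ?ltr0n // ler1n.
Qed.

(** The divided difference of [g] at [node 0], ..., [node (k - 1)] and the argument. *)
Fixpoint nq g k : C -> C := if k is k'.+1 then dq (nq g k') (node k') else g.

Lemma newton_identity g N w : g w =
  \sum_(l < N) nq g l (node l) * \prod_(m < l) (w - node m)
  + \prod_(m < N) (w - node m) * nq g N w.
Proof.
elim: N => [|N IH]; first by rewrite !big_ord0 add0r mul1r.
rewrite {1}IH !big_ord_recr /= -!addrA; congr (_ + _).
(* At the new node the new remainder vanishes whatever the default value of [dq] is, and the new
   summand is the old remainder. *)
have [->|wN] := eqVneq w (node N).
  by rewrite subrr mulr0 mul0r addr0 mulrC.
by rewrite /dq; field; rewrite subr_eq0.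
Qed.

Lemma diff_off_nq g N : (forall z, diff_at g z) ->
  diff_off [seq node m | m <- iota 0 N] (nq g N).
Proof.
move=> hg; elim: N => [|N IH].
  by split=> z *; [apply: hg | apply: diff_at_bounded].
have nN : node N \notin [seq node m | m <- iota 0 N].
  by rewrite (mem_map node_inj) mem_iota ltnn andbF.
have [h1 h2] := diff_off_dq nN IH; split=> // z hz; apply: h1; move: hz.
rewrite -addn1 iotaD map_cat mem_cat !inE !negb_or /= ?add0n ?inE.
by rewrite andbC.
Qed.

(** Each quotient costs a factor [38 / T]: the numerator is at most [1 + 18] times the previous
    bound by the maximum principle at the node, and the denominator is at least [T / 2], as the node
    has modulus at most 1 and [2 <= T]. *)
Lemma nq_annulus_bound g N (T M : R) : (forall z, diff_at g z) -> 2 <= T ->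
  (forall u, T <= normc u <= 2 * T -> normc (g u) <= M) ->
  forall u, T <= normc u <= 2 * T -> normc (nq g N u) <= M * (38 / T) ^+ N.
Proof.
move=> hg T2 hM; elim: N => [|N IH] u hu; first by rewrite expr0 mulr1 hM.
have nN : node N \notin [seq node m | m <- iota 0 N].
  by rewrite (mem_map node_inj) mem_iota ltnn andbF.
have n1 := node_le1 N.
have b1 : normc (nq g N (node N)) <= 18 * (M * (38 / T) ^+ N).
  by apply: weak_maximum nN (diff_off_nq N hg) IH; lra.
have b2 := IH u hu.
have b3 : T / 2 <= normc (u - node N) by have := nc_leB u (node N); lra.
rewrite /= /dq ncM ncV ler_pdivrMr; last by lra.
apply: le_trans (ncB _ _) _.
apply: le_trans (_ : M * (38 / T) ^+ N.+1 * (T / 2) <= _).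
  rewrite exprS; set q := (38 / T) ^+ N in b1 b2 *.
  by rewrite (_ : _ * (T / 2) = 19 * (M * q)); [lra | field; lra].
rewrite ler_wpM2l // mulr_ge0 ?exprn_ge0 ?divr_ge0 //; last by lra.
by apply: le_trans (nc_ge0 _) (hM u hu).
Qed.

(** At a node the remainder vanishes through its product. Elsewhere the maximum principle carries
    the annulus bound for [nq g N] inside to [w]. *)
Lemma newton_error g N (T M : R) w : (forall z, diff_at g z) -> 2 <= T ->
  (forall u, T <= normc u <= 2 * T -> normc (g u) <= M) -> normc w <= T / 2 ->
  normc (g w - \sum_(l < N) nq g l (node l) * \prod_(m < l) (w - node m))
    <= (normc w + 1) ^+ N * (18 * (M * (38 / T) ^+ N)).
Proof.
move=> hg T2 hM hw; rewrite {1}(newton_identity g N w) addrC addKr ncM.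
have M0 : 0 <= M.
  have T0 : 0 <= T by lra.
  apply: le_trans (nc_ge0 _) (hM T%:C%C _).
  by rewrite ncR ger0_norm //; lra.
have [wN|wN] := boolP (w \in [seq node m | m <- iota 0 N]).
  have [m hm ->] := mapP wN; move: hm; rewrite mem_iota add0n /= => hm.
  rewrite (bigD1 (Ordinal hm)) //= subrr mul0r nc0 mul0r.
  rewrite mulr_ge0 ?exprn_ge0 ?addr_ge0 ?nc_ge0 ?mulr_ge0 ?divr_ge0 //.
  by rewrite exprn_ge0 // divr_ge0 //; lra.
rewrite ler_pM ?nc_ge0 //; last first.
  have T0 : 0 < T by lra.
  exact: (weak_maximum T0 hw wN (diff_off_nq N hg) (nq_annulus_bound N hg T2 hM)).
rewrite nc_prod -[X in _ <= _ ^+ X]card_ord -prodr_const.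
apply: ler_prod => m _; rewrite nc_ge0 /=.
by apply: le_trans (ncB _ _) _; rewrite lerD2l node_le1.
Qed.

(* The difference quotient is entire off w, so the maximum principle turns a
   bound on the values into a Lipschitz bound. *)
Lemma entire_lipschitz g (T M : R) w z : (forall z, diff_at g z) -> 0 < T ->
  (forall u, normc u <= 2 * T -> normc (g u) <= M) ->
  normc w <= T / 2 -> normc z <= T / 2 ->
  normc (g z - g w) <= 72 * M / T * normc (z - w).
Proof.
move=> hg T0 hM hw hz; have [->|zw] := eqVneq z w.
  by rewrite !subrr nc0 mulr0.
have g0 : diff_off [::] g by split=> x *; [apply: hg | apply: diff_at_bounded].
have wE : w \notin [::] by [].
(* On the annulus the quotient is at most [2 * M / (T / 2) = 4 * M / T]; the factor 18 then yields
   72. *)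
have := @weak_maximum _ [:: w] (dq g w) z T (4 * M / T) T0 hz.
rewrite inE => /(_ zw (diff_off_dq wE g0)).
rewrite /dq ncM ncV ler_pdivrMr ?nc_gt0 ?subr_eq0 // => H.
apply: le_trans (H _) _; last by rewrite le_eqVlt; apply/orP; left; apply/eqP; field; lra.
move=> u hu; have b : T / 2 <= normc (u - w) by have := nc_leB u w; lra.
have M0 : 0 <= M.
  by apply: le_trans (nc_ge0 _) (hM 0 _); rewrite nc0; lra.
rewrite ncM ncV ler_pdivrMr; last by lra.
apply: le_trans (ncB _ _) _.
apply: le_trans (_ : 4 * M / T * (T / 2) <= _); last first.
  by rewrite ler_wpM2l // divr_ge0 ?mulr_ge0 //; lra.
have h1 := hM u ltac:(lra); have h2 := hM w ltac:(lra).
by rewrite (_ : _ * (T / 2) = 2 * M); [lra | field; lra].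
Qed.

End Newton.

(** * Entire functions of several variables *)

Section Holomorphic.
Variables (R : realType) (n : nat).
Local Notation C := R[i].
Local Notation normc := (@Normc.normc R).
Implicit Types (f g : ('I_n -> C) -> C) (x y : 'I_n -> C).

Lemma diff_at_cst (c z : C) : diff_at (fun _ => c) z.
Proof.
by exists 0 => e e0; exists 1 => // u _; rewrite mul0r !subrr nc0 mulr_ge0 ?nc_ge0 ?ltW.
Qed.

Lemma diff_at_id (z : C) : diff_at id z.
Proof.
by exists 1 => e e0; exists 1 => // u _; rewrite mul1r subrr nc0 mulr_ge0 ?nc_ge0 ?ltW.
Qed.

Lemma diff_atD (f g : C -> C) z : diff_at f z -> diff_at g z ->
  diff_at (fun u => f u + g u) z.
Proof.
move=> [L HL] [K HK]; exists (L + K) => e e0.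
have [d d0 Hd] := HL (e / 2) ltac:(lra); have [d' d'0 Hd'] := HK (e / 2) ltac:(lra).
exists (Num.min d d'); first by rewrite lt_min d0.
move=> u; rewrite lt_min => /andP[/Hd h1 /Hd' h2].
have -> : f u + g u - (f z + g z) - (L + K) * (u - z) =
  (f u - f z - L * (u - z)) + (g u - g z - K * (u - z)) by ring.
by apply: le_trans (ncD _ _) _; lra.
Qed.

Lemma diff_atM (f g : C -> C) z : diff_at f z -> diff_at g z ->
  diff_at (fun u => f u * g u) z.
Proof.
move=> [L HL] [K HK]; exists (L * g z + f z * K) => e e0.
have [d1 d10 H1] := HL 1 ltr01; have [d2 d20 H2] := HK 1 ltr01.
have F0 := nc_ge0 (f z); have G0 := nc_ge0 (g z).
have L0 := nc_ge0 L; have K0 := nc_ge0 K.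
pose e' := e / 3 / (normc (f z) + normc (g z) + 1).
have e'0 : 0 < e' by rewrite !divr_gt0 //; lra.
have [d3 d30 H3] := HL e' e'0; have [d4 d40 H4] := HK e' e'0.
pose d5 := e / 3 / ((normc L + 1) * (normc K + 1)).
have d50 : 0 < d5 by rewrite !divr_gt0 ?mulr_gt0 //; lra.
exists (Num.min (Num.min d1 d2) (Num.min (Num.min d3 d4) d5)).
  by rewrite !lt_min d10 d20 d30 d40 d50.
move=> u; rewrite !lt_min => /andP[/andP[u1 u2] /andP[/andP[u3 u4] u5]].
have A : normc (f u - f z) <= (normc L + 1) * normc (u - z).
  rewrite -[f u - f z](subrK (L * (u - z))); apply: le_trans (ncD _ _) _.
  by rewrite ncM; have := H1 u u1; lra.
have B : normc (g u - g z) <= (normc K + 1) * normc (u - z).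
  rewrite -[g u - g z](subrK (K * (u - z))); apply: le_trans (ncD _ _) _.
  by rewrite ncM; have := H2 u u2; lra.
have -> : f u * g u - f z * g z - (L * g z + f z * K) * (u - z) =
  (f u - f z - L * (u - z)) * g z + f z * (g u - g z - K * (u - z))
  + (f u - f z) * (g u - g z) by ring.
apply: le_trans (ncD _ _) _; apply: le_trans (lerD (ncD _ _) (lexx _)) _.
rewrite !ncM.
have uz := nc_ge0 (u - z).
have C1 : normc (f u - f z - L * (u - z)) * normc (g z) <= e / 3 * normc (u - z).
  apply: le_trans (ler_wpM2r G0 (H3 u u3)) _.
  rewrite mulrAC ler_wpM2r // /e' mulrAC ler_pdivrMr; last by lra.
  by rewrite ler_wpM2l //; lra.
have C2 : normc (f z) * normc (g u - g z - K * (u - z)) <= e / 3 * normc (u - z).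
  apply: le_trans (ler_wpM2l F0 (H4 u u4)) _.
  rewrite mulrA ler_wpM2r // /e' mulrC mulrAC ler_pdivrMr; last by lra.
  by rewrite ler_wpM2l //; lra.
have C3 : normc (f u - f z) * normc (g u - g z) <= e / 3 * normc (u - z).
  apply: le_trans (ler_pM (nc_ge0 _) (nc_ge0 _) A B) _.
  rewrite mulrA ler_wpM2r // mulrAC mulrC -ler_pdivlMr ?mulr_gt0 //; try lra.
  exact: ltW.
by lra.
Qed.

(** * Coordinate slices and closure properties of entire functions *)

Definition upd x (j : 'I_n) (t : C) : 'I_n -> C := fun k => if k == j then t else x k.

Lemma upd_id x j : upd x j (x j) = x.
Proof. by apply: funext => k; rewrite /upd; case: eqP => [->|]. Qed.

Lemma upd_upd x j s t : upd (upd x j s) j t = upd x j t.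
Proof. by apply: funext => k; rewrite /upd; case: eqP. Qed.

Lemma upd_updC x j k s t : j != k -> upd (upd x j s) k t = upd (upd x k t) j s.
Proof.
move=> jk; apply: funext => l; rewrite /upd.
by case: (eqVneq l k) => // ->; rewrite eq_sym (negbTE jk).
Qed.

(** Joint continuity and separate differentiability with real moduli. Slices are written with [upd],
    so that the one-variable results apply to them directly. *)
Definition hol f :=
  (forall x (e : R), 0 < e -> exists2 d, 0 < d &
     forall y, (forall j, normc (y j - x j) < d) -> normc (f y - f x) < e) /\
  (forall x j z, diff_at (fun t => f (upd x j t)) z).

Lemma holomorphic_hol f : holomorphic f -> hol f.
Proof.
move=> hf; split=> [x e e0|x j z].
  have [/(_ e%:C%C)] := hf x; rewrite ltcR => /(_ e0)[d /posC_real[d' d'0 ->] Hd] _.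
  by exists d' => // y hy; rewrite -ltcR; apply: Hd => j; rewrite ltcR.
have [_ /(_ j)[L HL]] := hf (upd x j z).
exists L => e e0; have := HL e%:C%C; rewrite ltcR => /(_ e0)[d /posC_real[d' d'0 ->] Hd].
exists d' => // u hu; have := Hd (u - z); rewrite ltcR => /(_ hu).
rewrite [in X in _ <= X -> _]normE -rmorphM /= lecR.
suff -> : (fun k => if k == j then upd x j z k + (u - z) else upd x j z k) = upd x j u by [].
by apply: funext => k; rewrite /upd; case: eqP => // _; rewrite addrC subrK.
Qed.

Lemma hol_cst c : hol (fun _ => c).
Proof.
split=> [x e e0|x j z]; last exact: diff_at_cst.
by exists 1 => // y _; rewrite subrr nc0.
Qed.

Lemma hol_proj k : hol (fun x => x k).
Proof.
split=> [x e e0|x j z]; first by exists e => // y; apply.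
by rewrite /upd; case: eqP => _; [apply: diff_at_id | apply: diff_at_cst].
Qed.

Lemma holD f g : hol f -> hol g -> hol (fun x => f x + g x).
Proof.
move=> [f1 f2] [g1 g2]; split=> [x e e0|x j z]; last exact: diff_atD.
have [d d0 Hd] := f1 x (e / 2) ltac:(lra); have [d' d'0 Hd'] := g1 x (e / 2) ltac:(lra).
exists (Num.min d d'); first by rewrite lt_min d0.
move=> y hy; have /Hd h1 j : normc (y j - x j) < d by have := hy j; rewrite lt_min => /andP[].
have /Hd' h2 j : normc (y j - x j) < d' by have := hy j; rewrite lt_min => /andP[].
have -> : f y + g y - (f x + g x) = (f y - f x) + (g y - g x) by ring.
by apply: le_lt_trans (ncD _ _) _; lra.
Qed.

Lemma holM f g : hol f -> hol g -> hol (fun x => f x * g x).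
Proof.
move=> [f1 f2] [g1 g2]; split=> [x e e0|x j z]; last exact: diff_atM.
have F0 := nc_ge0 (f x); have G0 := nc_ge0 (g x).
pose e1 := Num.min 1 (e / (normc (f x) + normc (g x) + 2)).
have e10 : 0 < e1 by rewrite lt_min ltr01 divr_gt0 //; lra.
have [d d0 Hd] := f1 x e1 e10; have [d' d'0 Hd'] := g1 x e1 e10.
exists (Num.min d d'); first by rewrite lt_min d0.
move=> y hy; have /Hd h1 j : normc (y j - x j) < d by have := hy j; rewrite lt_min => /andP[].
have /Hd' h2 j : normc (y j - x j) < d' by have := hy j; rewrite lt_min => /andP[].
have -> : f y * g y - f x * g x =
  (f y - f x) * (g y - g x) + (f x * (g y - g x) + (f y - f x) * g x) by ring.
apply: le_lt_trans (ncD _ _) _; apply: le_lt_trans (lerD (lexx _) (ncD _ _)) _.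
rewrite !ncM.
have [a1 a2] : e1 <= 1 /\ e1 * (normc (f x) + normc (g x) + 2) <= e.
  split; first by rewrite ge_min lexx.
  by rewrite -ler_pdivlMr ?ge_min ?lexx ?orbT //; lra.
have P0 := nc_ge0 (f y - f x); have Q0 := nc_ge0 (g y - g x).
by clearbody e1; nra.
Qed.

Lemma hol_slice f j z : hol f -> hol (fun x => f (upd x j z)).
Proof.
move=> [f1 f2]; split=> [x e e0|x k w].
  have [d d0 Hd] := f1 (upd x j z) e e0; exists d => // y hy; apply: Hd => k.
  by rewrite /upd; case: eqP => // _; rewrite subrr nc0.
have [->|kj] := eqVneq k j.
  by under [fun t => _]funext do rewrite upd_upd; apply: diff_at_cst.
by under [fun t => _]funext do rewrite upd_updC //; apply: f2.
Qed.

Lemma hol_prod (I : Type) (s : seq I) (F : I -> ('I_n -> C) -> C) :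
  (forall i, hol (F i)) -> hol (fun x => \prod_(i <- s) F i x).
Proof.
move=> hF; elim: s => [|i s IH].
  by under [fun x => _]funext do rewrite big_nil; apply: hol_cst.
by under [fun x => _]funext do rewrite big_cons; apply: holM.
Qed.

Lemma hol_meval (p : {mpoly C[n]}) : hol (fun x => p.@[x]).
Proof.
elim/mpolyind: p => [|c m p _ _ IH].
  by under [fun x => _]funext do rewrite meval0; apply: hol_cst.
under [fun x => _]funext do rewrite mevalD mevalZ mevalX.
apply: holD IH; apply: holM; first exact: hol_cst.
apply: hol_prod => i; elim: (m i) => [|k IH].
  by under [fun x => _]funext do rewrite expr0; apply: hol_cst.
by under [fun x => _]funext do rewrite exprS; apply: holM IH; apply: hol_proj.
Qed.

(** The denominator [z - node k] does not depend on [x], so dividing by it is multiplication by a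
    constant. *)
Lemma hol_nq f j k z : hol f -> hol (fun x => nq (fun t => f (upd x j t)) k z).
Proof.
move=> hf; elim: k z => [|k IH] z /=; first exact: hol_slice.
rewrite /dq; apply: holM; last exact: hol_cst.
apply: holD; first exact: IH.
under [fun x => _]funext do rewrite -mulN1r.
by apply: holM; [apply: hol_cst | apply: IH].
Qed.

End Holomorphic.

(** * Standard parts along an ultrafilter *)

Section Ultrafilter.
Variables (R : realType) (U : (nat -> Prop) -> Prop).
Hypothesis hU : is_free_ultrafilter U.
Local Notation C := R[i].
Local Notation normc := (@Normc.normc R).

Lemma uf_mono (A B : nat -> Prop) : U A -> (forall i, A i -> B i) -> U B.
Proof. by case: hU => _ + _ _ _; apply. Qed.

Lemma uf_and (A B : nat -> Prop) : U A -> U B -> U (fun i => A i /\ B i).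
Proof. by case: hU => _ _ + _ _; apply. Qed.

Lemma uf_all (A : nat -> Prop) : (forall i, A i) -> U A.
Proof. by move=> hA; case: hU => -[hT _] _ _ _ _; apply: uf_mono hT _. Qed.

Lemma uf_not (A : nat -> Prop) : ~ U A -> U (fun i => ~ A i).
Proof. by case: hU => _ _ _ /(_ A)[]. Qed.

Lemma uf_ex (A : nat -> Prop) : U A -> exists i, A i.
Proof.
move=> hA; apply: contrapT => nA; case: hU => -[_ hF] _ _ _ _; apply: hF.
by apply: uf_mono hA _ => i Ai; apply: nA; exists i.
Qed.

Lemma uf_ge K : U (fun i => (K <= i)%N).
Proof.
elim: K => [|K IH]; first exact: uf_all.
have hK : U (fun i => i <> K) by apply: uf_not; case: hU.
apply: uf_mono (uf_and IH hK) _ => i [Ki /eqP iK].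
by rewrite ltn_neqAle eq_sym iK.
Qed.

Lemma uf_finite k (A : 'I_k -> nat -> Prop) :
  (forall j, U (A j)) -> U (fun i => forall j, A j i).
Proof.
move=> hA; have : U (fun i => forall j, j \in enum 'I_k -> A j i).
  elim: (enum _) => [|j s IH]; first exact: uf_all.
  apply: uf_mono (uf_and (hA j) IH) _ => i [h1 h2] l.
  by rewrite inE => /predU1P[->|/h2].
by move=> /uf_mono; apply=> i h j; apply: h; rewrite mem_enum.
Qed.

(** [kap i] is the largest [K <= i] with [A K i], or 0 if there is none. The cap [K <= i] makes the
    maximum exist and costs nothing, since [U] is free and contains every tail. *)
Lemma uf_overspill (A : nat -> nat -> Prop) : (forall k, U (A k)) ->
  exists kap : nat -> nat, forall K, U (fun i => (K <= kap i)%N /\ A (kap i) i).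
Proof.
move=> hA.
have /choice[kap Hkap] : forall i, exists k, forall K, (K <= i)%N -> A K i ->
    (K <= k)%N /\ A k i.
  move=> i; have [[K0 [K0i AK0]]|no] := pselect (exists K, (K <= i)%N /\ A K i); last first.
    by exists 0%N => K Ki AK; case: no; exists K.
  have ex : exists K, (K <= i)%N && `[< A K i >].
    by exists K0; rewrite K0i; apply/asboolP.
  have ub K : (K <= i)%N && `[< A K i >] -> (K <= i)%N by case/andP.
  exists (ex_maxn ex ub); case: ex_maxnP => k /andP[_ /asboolP Ak] kmax K Ki AK.
  by split=> //; apply: kmax; rewrite Ki; apply/asboolP.
exists kap => K; apply: uf_mono (uf_and (uf_ge K) (hA K)) _ => i [Ki AK].
exact: Hkap AK.
Qed.

(** The standard part is the supremum of the reals that lie below [u] on a set of [U]. *)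
Lemma real_standard_part (u : nat -> R) B : U (fun i => `|u i| <= B) ->
  exists a, forall e, 0 < e -> U (fun i => `|u i - a| < e).
Proof.
move=> hB; pose E : classical_sets.set R := fun t => U (fun i => t <= u i).
have E0 : E (- B) by apply: uf_mono hB _ => i; rewrite ler_norml => /andP[].
have ubE : classical_sets.ubound E B.
  move=> t /(uf_and hB)/uf_ex[i []]; rewrite ler_norml => /andP[_ h1] h2.
  exact: le_trans h2 h1.
have hE : classical_sets.has_sup E by split; [exists (- B) | exists B].
exists (sup E) => e e0.
have [t Et ht] := sup_adherent e0 hE.
have nE : ~ E (sup E + e / 2).
  by move=> /(sup_upper_bound hE); lra.
apply: uf_mono (uf_and Et (uf_not nE)) _ => i [h1 /negP]; rewrite -ltNge => h2.
by rewrite ltr_norml; lra.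
Qed.

Lemma standard_part (u : nat -> C) B : U (fun i => normc (u i) <= B) ->
  exists a, forall e, 0 < e -> U (fun i => normc (u i - a) < e).
Proof.
move=> hB.
have [|a Ha] := @real_standard_part (fun i => complex.Re (u i)) B.
  by apply: uf_mono hB _ => i; apply: le_trans (absRe_le_nc _).
have [|b Hb] := @real_standard_part (fun i => complex.Im (u i)) B.
  by apply: uf_mono hB _ => i; apply: le_trans (absIm_le_nc _).
exists (Complex a b) => e e0; have e20 : 0 < e / 2 by lra.
apply: uf_mono (uf_and (Ha _ e20) (Hb _ e20)) _ => i [h1 h2].
by apply: le_lt_trans (nc_le_ReIm _) _; move: h1 h2; case: (u i) => p q /=; lra.
Qed.

Lemma standard_point n (x : nat -> 'I_n -> C) B :
  (forall i j, normc (x i j) <= B) ->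
  exists a, forall e, 0 < e -> U (fun i => forall j, normc (x i j - a j) < e).
Proof.
move=> hB; have /choice[a Ha] : forall j, exists b, forall e, 0 < e ->
    U (fun i => normc (x i j - b) < e).
  by move=> j; apply: (@standard_part _ B); apply: uf_all.
by exists a => e e0; apply: uf_finite => j; apply: Ha.
Qed.

Lemma standard_point_le n (x : nat -> 'I_n -> C) a B :
  (forall i j, normc (x i j) <= B) ->
  (forall e, 0 < e -> U (fun i => forall j, normc (x i j - a j) < e)) ->
  forall j, normc (a j) <= B.
Proof.
move=> hB ha j; apply/ler_addgt0Pr => e /ha/uf_ex[i /(_ j) h].
by have := hB i j; have := nc_leB (a j) (x i j); rewrite ncC; lra.
Qed.

Definition polydisk n (r : R) (x : 'I_n -> C) := forall j, normc (x j) <= r.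

(** Compactness through [U]: points where the modulus of [f] exceeds [i] would have a standard part
    [a], and continuity at [a] bounds [f] on a set of [U]. *)
Lemma hol_bounded n (f : ('I_n -> C) -> C) (r : R) : hol f ->
  exists B, forall x, polydisk r x -> normc (f x) <= B.
Proof.
move=> [fc _]; apply: contrapT => nB.
have /choice[x Hx] : forall i : nat, exists x, polydisk r x /\ i%:R < normc (f x).
  move=> i; apply: contrapT => nx; apply: nB; exists i%:R => x hx.
  by rewrite leNgt; apply/negP => h; apply: nx; exists x.
have [a Ha] := standard_point (fun i => (Hx i).1).
have [d d0 Hd] := fc a 1 ltr01.
have [i [h1]] := uf_ex (uf_and (Ha d d0) (uf_ge (Num.truncn (normc (f a) + 1)).+1)).
move/Hd: h1 => h1; rewrite -(ler_nat R) => h2.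
have h3 := truncnS_gt (normc (f a) + 1).
by have := (Hx i).2; have := nc_leB (f (x i)) (f a); lra.
Qed.

End Ultrafilter.

(** * Polynomial approximation of entire functions *)

Section Approximation.
Variables (R : realType) (U : (nat -> Prop) -> Prop) (n : nat).
Hypothesis hU : is_free_ultrafilter U.
Local Notation C := R[i].
Local Notation normc := (@Normc.normc R).

Lemma slice_bounded (f : ('I_n -> C) -> C) (r : R) : hol f -> 0 <= r ->
  exists2 M, 0 <= M & forall x j t, polydisk r x -> normc t <= r ->
    normc (f (upd x j t)) <= M.
Proof.
move=> hf r0; have [M HM] := hol_bounded hU r hf; exists M.
  by apply: le_trans (nc_ge0 _) (HM (fun=> 0) _) => j; rewrite nc0.
by move=> x j t hx ht; apply: HM => k; rewrite /upd; case: eqP.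
Qed.

(** Induction on the number of variables that [f] depends on. Newton interpolation in the last of
    them leaves coefficients that depend on the earlier ones only, to which the induction hypothesis
    applies. *)
Lemma hol_poly_approx_aux k (f : ('I_n -> C) -> C) (r e : R) :
  (k <= n)%N -> hol f -> 0 <= r -> 0 < e ->
  (forall x y, (forall j : 'I_n, (j < k)%N -> x j = y j) -> f x = f y) ->
  exists p : {mpoly C[n]}, forall x, polydisk r x -> normc (f x - p.@[x]) < e.
Proof.
elim: k f e => [|k IH] f e kn hf r0 e0 dep.
  exists (f (fun=> 0))%:MP => x _.
  by rewrite mevalC (dep x (fun=> 0)) // subrr nc0.
(* This [T] makes [(normc (x j) + 1) * (38 / T)] at most [1 / 2], so the interpolation error decays
   like [2 ^- N]. *)
pose j := Ordinal kn; pose T := 76 * (r + 1).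
have T0 : 0 < T by rewrite /T; lra.
have T20 : 0 <= 2 * T by lra.
have [M M0 HM] := slice_bounded hf T20.
have [N HN] : exists N : nat, 18 * M / 2 ^+ N < e / 2.
  exists (Num.truncn (18 * M / (e / 2))).+1.
  rewrite ltr_pdivrMr ?exprn_gt0 // [e / 2 * _]mulrC -ltr_pdivrMr; last by lra.
  apply: lt_le_trans (truncnS_gt _) _.
  by rewrite -natrX ler_nat ltnW // ltn_expl.
pose c l x := nq (fun t => f (upd x j t)) l (node R l).
(* There are [N] coefficient errors, each multiplied by at most [(r + 1) ^+ N]; [N.+1] keeps the
   denominator nonzero. *)
pose e' := e / 2 / (N.+1%:R * (r + 1) ^+ N).
have e'0 : 0 < e' by rewrite !divr_gt0 // mulr_gt0 // exprn_gt0 //; lra.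
have /choice[p Hp] : forall l, exists p : {mpoly C[n]}, forall x, polydisk r x ->
    normc (c l x - p.@[x]) < e'.
  move=> l; apply: IH => //; first exact: ltnW.
    exact: hol_nq.
  move=> x y hxy; rewrite /c; congr (nq _ _ _); apply: funext => t.
  apply: dep => i; rewrite ltnS leq_eqVlt /upd => /predU1P[ik|ik].
    by rewrite (_ : i = j) ?eqxx //; apply: val_inj.
  by case: eqP => // _; apply: hxy.
exists (\sum_(l < N) p l * \prod_(m < l) ('X_j - (node R m)%:MP)) => x hx.
have -> : (\sum_(l < N) p l * \prod_(m < l) ('X_j - (node R m)%:MP)).@[x]
   = \sum_(l < N) (p l).@[x] * \prod_(m < l) (x j - node R m).
  rewrite raddf_sum /=; apply: eq_bigr => l _; rewrite mevalM rmorph_prod /=.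
  by congr (_ * _); apply: eq_bigr => m _; rewrite mevalB mevalXU mevalC.
set S := \sum_(l < N) _ * _.
pose S' := \sum_(l < N) c l x * \prod_(m < l) (x j - node R m).
apply: le_lt_trans (nc_leD3 _ S' _) _.
have h1 : normc (f x - S') <= 18 * M / 2 ^+ N.
  rewrite -{1}(upd_id x j).
  apply: le_trans (newton_error (T := T) (M := M) N _ _ _ _) _.
  - by move=> z; apply: hf.2.
  - by rewrite /T; lra.
  - by move=> u hu; apply: HM; [move=> i; have := hx i; rewrite /T; lra | lra].
  - by have := hx j; rewrite /T; lra.
  have -> : (normc (x j) + 1) ^+ N * (18 * (M * (38 / T) ^+ N)) =
      18 * M * ((normc (x j) + 1) * (38 / T)) ^+ N by rewrite [in RHS]exprMn; move: (_ ^+ N) (_ ^+ N) => a b; ring.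
  rewrite -exprVn ler_wpM2l ?mulr_ge0 //.
  apply: lerXn2r; rewrite ?nnegrE ?invr_ge0 //.
    by rewrite mulr_ge0 ?divr_ge0 ?addr_ge0 ?nc_ge0 // ltW.
  by rewrite mulrA ler_pdivrMr // /T; have := hx j; lra.
have h2 : normc (S' - S) <= e / 2.
  rewrite /S' /S -sumrB; apply: le_trans (nc_sum _ _) _.
  apply: le_trans (_ : \sum_(l < N) e' * (r + 1) ^+ N <= _).
    apply: ler_sum => l _; rewrite -mulrBl ncM.
    rewrite ler_pM ?nc_ge0 //; first by apply: ltW; apply: Hp.
    rewrite nc_prod; apply: le_trans (_ : (r + 1) ^+ l <= _).
      rewrite -[X in _ <= _ ^+ X]card_ord -prodr_const.
      apply: ler_prod => m _; rewrite nc_ge0 /=.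
      by apply: le_trans (ncB _ _) _; rewrite lerD ?node_le1.
    by apply: ler_weXn2l; [lra | apply: ltnW].
  rewrite sumr_const card_ord -[_ *+ N]mulr_natr /e'.
  have q0 : 0 < (r + 1) ^+ N by rewrite exprn_gt0 //; lra.
  rewrite (_ : _ * N%:R = e / 2 * (N%:R / N.+1%:R)).
    rewrite -[leRHS]mulr1; apply: ler_wpM2l; first by lra.
    by rewrite ler_pdivrMr ?ltr0n // mul1r ler_nat.
  by field; rewrite (gt_eqF q0) nat1r pnatr_eq0.
by lra.
Qed.

Lemma hol_poly_approx (f : ('I_n -> C) -> C) (r e : R) : hol f -> 0 < e ->
  exists p : {mpoly C[n]}, forall x, polydisk r x -> normc (f x - p.@[x]) < e.
Proof.
move=> hf e0.
have [||x y hxy|p Hp] := @hol_poly_approx_aux n f (Num.max 0 r) e (leqnn n) hf => //.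
- by rewrite le_max lexx.
- by congr f; apply: funext => j; apply: hxy.
exists p => x hx; apply: Hp => j; apply: le_trans (hx j) _.
by rewrite le_max lexx orbT.
Qed.

End Approximation.

(** * Internal polynomials *)

Section InternalPolynomials.
Variables (R : realType) (U : (nat -> Prop) -> Prop).
Hypothesis hU : is_free_ultrafilter U.
Local Notation C := R[i].
Local Notation normc := (@Normc.normc R).

Lemma bndP (u : nat -> C) : bnd U u <-> exists B : R, U (fun i => normc (u i) <= B).
Proof.
split=> [[r hr]|[B hB]].
  by exists (complex.Re r); apply: uf_mono hr _ => // i; apply: nc_le_re.
by exists B%:C%C; apply: uf_mono hB _ => // i; rewrite nc_leC.
Qed.

Lemma stpartP (u : nat -> C) c :
  stpart U u c <-> forall e : R, 0 < e -> U (fun i => normc (u i - c) < e).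
Proof.
split=> [h e e0|h e /posC_real[d d0 ->]].
  by apply: uf_mono (h e%:C%C _) _ => //; rewrite ?ltcR // => i; rewrite nc_ltC.
by apply: uf_mono (h d d0) _ => // i; rewrite nc_ltC.
Qed.

Lemma bnd_ptP n (x : nat -> 'I_n -> C) : bnd_pt U x ->
  exists B, U (fun i => polydisk B (x i)).
Proof.
move=> hx; have /choice[B HB] : forall j, exists B : R, U (fun i => normc (x i j) <= B).
  by move=> j; apply/bndP; apply: hx.
exists (\sum_j `|B j|); apply: uf_mono (uf_finite hU HB) _ => // i h j.
apply: le_trans (h j) _; apply: le_trans (ler_norm _) _.
by rewrite (bigD1 j) //= lerDl sumr_ge0.
Qed.

Lemma polydisk_bnd_pt n (x : nat -> 'I_n -> C) B :
  U (fun i => polydisk B (x i)) -> bnd_pt U x.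
Proof. by move=> h j; apply/bndP; exists B; apply: uf_mono h _ => // i; apply. Qed.

Lemma const_bnd_pt n (x : 'I_n -> C) : bnd_pt U (fun=> x).
Proof. by move=> j; apply/bndP; exists (normc (x j)); apply: uf_all. Qed.

(** Otherwise, for each [k], the value [k] is exceeded on the polydisk for [U]-almost all [i];
    overspill then yields one bounded internal point where [P] is unbounded. *)
Lemma bCX_bounded n (P : intpoly R n) r : bCX U P ->
  exists B, U (fun i => forall x, polydisk r x -> normc (P i).@[x] <= B).
Proof.
move=> hP; apply: contrapT => nB.
pose A (k i : nat) := exists x, polydisk r x /\ k%:R < normc (P i).@[x].
have hA k : U (A k).
  have /(uf_not hU) : ~ U (fun i => forall x, polydisk r x -> normc (P i).@[x] <= k%:R).
    by move=> h; apply: nB; exists k%:R.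
  move=> /(uf_mono hU); apply=> i h; apply: contrapT => nx; apply: h => x hx.
  by rewrite leNgt; apply/negP => h; apply: nx; exists x.
have [kap Hkap] := uf_overspill hU hA.
have /choice[x Hx] : forall i, exists x, A (kap i) i ->
    polydisk r x /\ (kap i)%:R < normc (P i).@[x].
  move=> i; have [[x hx]|nx] := pselect (A (kap i) i); first by exists x.
  by exists (fun=> 0) => /nx.
have /hP/bndP[B HB] : bnd_pt U x.
  by apply: (@polydisk_bnd_pt _ _ r); apply: uf_mono (Hkap 0%N) _ => // i [_ /Hx[]].
have [i [h1 [h2 /Hx[_ h3]]]] := uf_ex hU (uf_and hU HB (Hkap (Num.truncn B).+1)).
have h4 := truncnS_gt B; move: h2; rewrite -(ler_nat R) => h2.
by lra.
Qed.

(** The path [w] from [y] to [x] changes one coordinate at a time, and the one-variable estimate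
    bounds each of its [n] steps. *)
Lemma hol_lipschitz n (f : ('I_n -> C) -> C) (T M d : R) x y : hol f -> 0 < T ->
  (forall u, polydisk (2 * T) u -> normc (f u) <= M) ->
  polydisk (T / 2) x -> polydisk (T / 2) y -> (forall j, normc (x j - y j) <= d) ->
  normc (f x - f y) <= n%:R * (72 * M / T * d).
Proof.
move=> hf T0 hM hx hy hd.
have M0 : 0 <= M.
  by apply: le_trans (nc_ge0 _) (hM (fun=> 0) _) => j; rewrite nc0; lra.
pose w k : 'I_n -> C := fun j => if (j < k)%N then x j else y j.
have hw k : polydisk (T / 2) (w k) by move=> j; rewrite /w; case: ifP.
have key k : (k <= n)%N -> normc (f (w k) - f y) <= k%:R * (72 * M / T * d).
  elim: k => [_|k IH kn].
    by rewrite (_ : w 0%N = y) ?subrr ?nc0 ?mul0r //; apply: funext.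
  pose j := Ordinal kn.
  have e1 : w k.+1 = upd (w k) j (x j).
    apply: funext => l; rewrite /w /upd ltnS leq_eqVlt.
    have -> : (l == j) = (l == k :> nat) by [].
    by case: eqP => //= lk; congr x; apply: val_inj.
  have e2 : w k = upd (w k) j (y j).
    rewrite -{1}(upd_id (w k) j); congr upd.
    by rewrite /w ltnn.
  apply: le_trans (nc_leD3 _ (f (w k)) _) _.
  rewrite -natr1 mulrDl mul1r addrC; apply: lerD; first exact: IH (ltnW kn).
  rewrite e1 {2}e2.
  apply: le_trans (entire_lipschitz (T := T) (M := M)
     (g := fun t => f (upd (w k) j t)) _ _ _ _ _) _ => //.
  - by move=> z; apply: hf.2.
  - move=> u hu; apply: hM => l; rewrite /upd; case: eqP => // _.
    by have := hw k l; lra.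
  by rewrite ler_wpM2l // divr_ge0 ?mulr_ge0 // ltW.
have := key n (leqnn n); rewrite (_ : w n = x) //.
by apply: funext => j; rewrite /w ltn_ord.
Qed.

(** Counterexamples [x i] would have a standard part [a]. A Lipschitz constant common to [U]-almost
    all [G i] compares the values at [x i] and [a], and the value at the standard point [a] is
    infinitesimal. *)
Lemma infinitesimal_uniform n (G : intpoly R n) r e : bCX U G ->
  is_st U G (fun=> 0) -> 0 < e ->
  U (fun i => forall x, polydisk r x -> normc (G i).@[x] < e).
Proof.
move=> bG G0 e0; apply: contrapT => /(uf_not hU) nU.
(* A nonnegative radius keeps the default point 0 in the polydisk. *)
pose r' := Num.max 0 r; have r'0 : 0 <= r' by rewrite le_max lexx.
have rr' : r <= r' by rewrite le_max lexx orbT.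
have /choice[x Hx] : forall i, exists x, polydisk r' x /\
   (~ (forall x, polydisk r x -> normc (G i).@[x] < e) -> e <= normc (G i).@[x]).
  move=> i; have [[x [hx1 hx2]]|nx] := pselect (exists x, polydisk r x /\ e <= normc (G i).@[x]).
    by exists x; split=> // j; apply: le_trans (hx1 j) _.
  exists (fun=> 0); split=> [j|h]; first by rewrite nc0.
  by exfalso; apply: h => x hx; rewrite ltNge; apply/negP => h; apply: nx; exists x.
have hx i := (Hx i).1.
have [a ha] := standard_point hU hx.
have hra : polydisk r' a := standard_point_le hU hx ha.
clearbody r'.
pose T := 2 * (r' + 1); have T0 : 0 < T by rewrite /T; lra.
have r'T : r' <= T / 2 by rewrite /T; lra.
have [B HB] := bCX_bounded (2 * T) bG.
pose K := n%:R * (72 * `|B| / T); have K0 : 0 <= K.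
  by rewrite mulr_ge0 ?ler0n // divr_ge0 ?(ltW T0) // mulr_ge0 ?normr_ge0 ?ler0n.
(* [K] is the Lipschitz constant, so moving by [d] changes the value by at most [e / 2]; [K + 1]
   avoids division by 0. *)
pose d := e / 2 / (K + 1); have d0 : 0 < d by apply: divr_gt0; lra.
have /stpartP/(_ (e / 2) ltac:(lra)) Ga := G0 a.
have [i [[h1 h2] [h3 h4]]] := uf_ex hU (uf_and hU (uf_and hU HB nU) (uf_and hU (ha d d0) Ga)).
have h5 := (Hx i).2 h2; rewrite subr0 in h4.
have h6 : normc ((G i).@[x i] - (G i).@[a]) <= n%:R * (72 * `|B| / T * d).
  apply: (hol_lipschitz (f := fun y => (G i).@[y])) T0 _ _ _ _.
  - exact: hol_meval.
  - by move=> u /h1 /le_trans; apply; apply: ler_norm.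
  - by move=> j; apply: le_trans (hx i j) _.
  - by move=> j; apply: le_trans (hra j) _.
  - by move=> j; apply: ltW.
have h7 : K * d <= e / 2.
  by rewrite /d mulrC mulrAC ler_pdivrMr; [rewrite ler_wpM2l //; lra | lra].
rewrite mulrA -/K in h6.
by have := nc_leB (G i).@[x i] (G i).@[a]; lra.
Qed.

(** * Lifting entire functions to internal polynomials, and embedding these in [Dn] *)

Lemma iotaX_eval n (p : {mpoly C[n]}) (x xi : 'I_n -> C) :
  (iotaX p).@[joinv x xi] = p.@[x].
Proof.
rewrite /iotaX comp_mpoly_meval; congr (_.@[_]); apply: funext => j.
by rewrite tnth_mktuple mevalXU /joinv (unsplitK (inl j : 'I_n + 'I_n)).
Qed.

Lemma iotaXB n (p q : {mpoly C[n]}) : iotaX (p - q) = iotaX p - iotaX q.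
Proof. exact: raddfB. Qed.

Lemma iotaX_Dn n (F : intpoly R n) : bCX U F -> Dn U (fun i => iotaX (F i)).
Proof.
move=> bF x xi hx _; have /bndP[B HB] := bF x hx.
by apply/bndP; exists B; apply: uf_mono HB _ => // i; rewrite iotaX_eval.
Qed.

Lemma bCXB n (F G : intpoly R n) : bCX U F -> bCX U G -> bCX U (fun i => F i - G i).
Proof.
move=> bF bG x hx; have /bndP[B HB] := bF x hx; have /bndP[D HD] := bG x hx.
apply/bndP; exists (B + D); apply: uf_mono (uf_and hU HB HD) _ => // i [h1 h2].
by rewrite mevalB; apply: le_trans (ncB _ _) _; apply: lerD.
Qed.

Lemma is_stB n (F G : intpoly R n) f g : is_st U F f -> is_st U G g ->
  is_st U (fun i => F i - G i) (fun x => f x - g x).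
Proof.
move=> hF hG x; apply/stpartP => e e0.
have /stpartP/(_ (e / 2) ltac:(lra)) h1 := hF x.
have /stpartP/(_ (e / 2) ltac:(lra)) h2 := hG x.
apply: uf_mono (uf_and hU h1 h2) _ => // i [{}h1 {}h2].
rewrite mevalB; set p := (F i).@[x] in h1 *; set q := (G i).@[x] in h2 *.
have -> : p - q - (f x - g x) = (p - f x) - (q - g x) by ring.
by apply: le_lt_trans (ncB _ _) _; lra.
Qed.

(** [F i] approximates [f] within [1 / (i + 1)] on the polydisk of radius [i]; any fixed radius and
    precision are reached for [U]-almost all [i]. *)
Lemma hol_internal n (f : ('I_n -> C) -> C) : hol f ->
  exists F, bCX U F /\ is_st U F f.
Proof.
move=> hf; have /choice[F HF] : forall i : nat, exists p : {mpoly C[n]},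
    forall x, polydisk i%:R x -> normc (f x - p.@[x]) < i.+1%:R^-1.
  by move=> i; apply: (hol_poly_approx hU) => //; rewrite invr_gt0 ltr0n.
have small (r e : R) : 0 < e ->
    U (fun i => forall x, polydisk r x -> normc (f x - (F i).@[x]) < e).
  move=> e0; apply: uf_mono (uf_and hU (uf_ge hU (Num.truncn r).+1)
    (uf_ge hU (Num.truncn e^-1).+1)) _ => // i [h1 h2] x hx.
  apply: lt_le_trans (HF i x _) _.
    move=> j; apply: le_trans (hx j) _; apply: le_trans (ltW (truncnS_gt _)) _.
    by rewrite ler_nat.
  rewrite -[e]invrK lef_pV2 ?posrE ?invr_gt0 ?ltr0n //.
  apply: le_trans (ltW (truncnS_gt _)) _.
  by rewrite ler_nat ltnW.
exists F; split=> [x /bnd_ptP[r hr]|x].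
  have [M HM] := hol_bounded hU r hf.
  apply/bndP; exists (M + 1).
  apply: uf_mono (uf_and hU hr (small r 1 ltr01)) _ => // i [h1 h2].
  have h3 := h2 _ h1; have h4 := HM _ h1.
  by have := nc_leB (F i).@[x i] (f (x i)); rewrite ncC; lra.
apply/stpartP => e e0.
have [r hr] := bnd_ptP (const_bnd_pt x).
apply: uf_mono (uf_and hU hr (small r e e0)) _ => // i [h1 h2].
by rewrite ncC; apply: h2.
Qed.

Lemma in_closure0 n (a : intpoly R n -> Prop) : is_ideal U a ->
  in_closure (st_ideal U a) (fun=> 0).
Proof.
move=> [_ a0 _ _ _] r e e0; exists (fun=> 0); split=> [|x _]; last by rewrite subr0 normr0.
exists (fun=> 0); split=> // x; apply/stpartP => d d0.
by apply: uf_all => // i; rewrite meval0 subr0 nc0.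
Qed.

(* If G is infinitesimal on bounded points, overspill gives an infinitesimal
   eta with G = O(eta ^ m.+1) there; so G = (eta ^- m * G) * eta ^ m. *)
Lemma infinitesimal_IApow n (a : intpoly R n -> Prop) m (G : intpoly R n) :
  is_ideal U a -> bCX U G -> is_st U G (fun=> 0) ->
  IApow U a m.+1 (fun i => iotaX (G i)).
Proof.
move=> ha bG G0; have cl0 := in_closure0 ha.
(* Radius and precision are tied to the same [k]: the overspilled [kap] gives a radius covering
   every bounded point together with the infinitesimal [eta]. *)
pose A (k i : nat) := forall x, polydisk k%:R x ->
  normc (G i).@[x] <= k.+1%:R^-1 ^+ m.+1.
have hA k : U (A k).
  have h := @infinitesimal_uniform _ G k%:R (k.+1%:R^-1 ^+ m.+1) bG G0.
  by apply: uf_mono (h _) _ => // [|i hi x /hi /ltW]; rewrite ?exprn_gt0 ?invr_gt0 ?ltr0n.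
have [kap Hkap] := uf_overspill hU hA.
pose eta i : R := (kap i).+1%:R^-1.
have eta0 i : 0 < eta i by rewrite invr_gt0 ltr0n.
have eta1 i : eta i <= 1 by rewrite invf_le1 ?ltr0n // ler1n.
have eta_small e : 0 < e -> U (fun i => eta i < e).
  move=> e0; apply: uf_mono (Hkap (Num.truncn e^-1).+1) _ => // i [h _].
  rewrite -[e]invrK ltf_pV2 ?posrE ?invr_gt0 ?ltr0n //.
  by apply: lt_le_trans (truncnS_gt _) _; rewrite ler_nat ltnW.
have G_eta (x : nat -> 'I_n -> C) : bnd_pt U x ->
    U (fun i => normc (G i).@[x i] <= eta i ^+ m.+1).
  move=> /bnd_ptP[r hr]; apply: uf_mono (uf_and hU hr (Hkap (Num.truncn r).+1)) _ => // i.
  move=> [h1 [h2 h3]]; apply: h3 => j; apply: le_trans (h1 j) _.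
  by apply: le_trans (ltW (truncnS_gt _)) _; rewrite ler_nat.
pose G' : intpoly R n := fun i => (eta i)%:C%C ^- m *: G i.
have G'_eta (x : nat -> 'I_n -> C) : bnd_pt U x ->
    U (fun i => normc (G' i).@[x i] <= eta i).
  move=> /G_eta h; apply: uf_mono h _ => // i h.
  rewrite mevalZ ncM ncV ncX ncR gtr0_norm // mulrC ler_pdivrMr ?exprn_gt0 //.
  by rewrite -exprS.
pose Q (j : 'I_m.+1) : intpoly R (n + n) := fun i =>
  if j == ord0 then iotaX (G' i) else ((eta i)%:C%C)%:MP.
exists Q; split; last first.
  apply: funext => i; rewrite big_ord_recl /Q eqxx /=.
  rewrite (eq_bigr (fun=> ((eta i)%:C%C)%:MP)) // prodr_const card_ord -rmorphXn /=.
  rewrite mulrC mul_mpolyC /G' /iotaX comp_mpolyZ scalerA mulfV ?scale1r //.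
  by rewrite expf_neq0 // -nc_gt0 ncR gtr0_norm.
move=> j; rewrite /Q; case: eqP => _.
  have bG' : bCX U G'.
    move=> x /G'_eta h; apply/bndP; exists 1.
    by apply: uf_mono h _ => // i /le_trans; apply.
  split; first exact: iotaX_Dn.
  exists (fun=> 0); split=> // x; apply/stpartP => e e0.
  apply: uf_mono (uf_and hU (G'_eta _ (const_bnd_pt x)) (eta_small e e0)) _ => // i [h1 h2].
  by rewrite iotaX_eval subr0; apply: le_lt_trans h1 h2.
split.
  move=> x xi _ _; apply/bndP; exists 1; apply: uf_all => // i.
  by rewrite mevalC ncR gtr0_norm.
exists (fun=> 0); split=> // x; apply/stpartP => e e0.
apply: uf_mono (eta_small e e0) _ => // i h.
by rewrite mevalC subr0 ncR gtr0_norm.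
Qed.

Lemma one_Dn n : Dn U (fun=> 1 : {mpoly C[n + n]}).
Proof.
move=> x xi _ _; apply/bndP; exists 1; apply: uf_all => // i.
by rewrite meval1 nc1.
Qed.

End InternalPolynomials.

(** * Existence of lifts, their independence modulo the ideal power, and the section identity *)

Unset Implicit Arguments.

Theorem theorem6p9 (R : realType) (U : (nat -> Prop) -> Prop) (n : nat)
  (a : intpoly R n -> Prop) :
  is_free_ultrafilter U -> is_ideal U a -> saturated U a ->
  forall m : nat,
    (* st : A -> A^an is onto, so s(f) := F mod I_A^(m+1) can be formed *)
    (forall f, holomorphic f ->
       exists F, bCX U F /\ exists h, is_st U F h /\
                   in_closure (st_ideal U a) (fun x => h x - f x)) /\
    (* s is well defined: it does not depend on the choice of F *)
    (forall F F' f f', bCX U F -> bCX U F' -> is_st U F f -> is_st U F' f' ->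
       in_closure (st_ideal U a) (fun x => f x - f' x) ->
       IApow_ideal U a m.+1 (fun i => iotaX (F i) - iotaX (F' i))) /\
    (* s is a section of st : D(A)/I_A^(m+1) -> A^an *)
    (forall F f, bCX U F -> is_st U F f ->
       Dn U (fun i => iotaX (F i)) /\
       forall x : 'I_n -> R[i], stpart U (fun i => (iotaX (F i)).@[joinv x (fun _ => 0)]) (f x)).
Proof.
move=> hU ha sat m; split; [|split].
- move=> f /holomorphic_hol/(hol_internal hU)[F [bF stF]].
  exists F; split=> //; exists f; split=> //.
  have -> : (fun x => f x - f x) = fun=> 0 by apply: funext => x; rewrite subrr.
  exact: in_closure0.
- move=> F F' f f' bF bF' stF stF' /sat[P [aP stP]].
  have bP : bCX U P by case: (ha) => + _ _ _ _; apply.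
  pose G i := F i - F' i - P i.
  have bG : bCX U G by apply: (bCXB hU) bP; apply: (bCXB hU).
  have stG : is_st U G (fun=> 0).
    have := is_stB hU (is_stB hU stF stF') stP.
    by congr (is_st _ _ _); apply: funext => x; rewrite subrr.
  (* The decomposition [F - F' = P + G] uses two generators with coefficients 1: [P] comes from the
     ideal, [G] from the power of the kernel. *)
  exists 2%N, (fun j i => if j == ord0 then iotaX (P i) else iotaX (G i)), (fun _ _ => 1).
  split.
  + move=> j; case: eqP => _.
      by left; exists P; split=> //; left.
    by right; apply: (infinitesimal_IApow hU).
  + by move=> j; apply: (one_Dn hU).
  have sum2 (p q : {mpoly R[i][n + n]}) :
      \sum_(j < 2) (if j == ord0 then p else q) * 1 = p + q.
    by rewrite big_ord_recl big_ord1 !mulr1.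
  apply: (uf_all hU) => i; apply: etrans (esym (sum2 (iotaX (P i)) (iotaX (G i)))).
  by rewrite /G !iotaXB [RHS]addrC subrK.
- move=> F f bF stF; split; first exact: (iotaX_Dn hU).
  move=> x; have := stF x; congr stpart; apply: funext => i.
  by rewrite iotaX_eval.
Qed.
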